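(* Let $M\subset\mathbb C^n$ and $M'\subset\mathbb C^{n'}$ be real analytic generic submanifolds (of positive CR dimension and positive codimension), $p\in M$, $p'\in M'$, and let $h:(M,p)\to_{\mathcal F}(M',p')$ be a formal holomorphic map. Write $m'=\dim_{CR}M'$. Then $h$ is S-nondegenerate at $p$ in each one of the following circumstances: (i) $n=n'$, $M$ and $M'$ have the same CR dimension and the same codimension, $M'$ is S-nondegenerate at $p'$, and $h$ is of formal rank $n$ at $p$ (i.e. its formal Jacobian matrix at $p$ is invertible); (ii) $M'$ is S-nondegenerate at $p'$ and $h$ induces a formal map $(S_{\bar p},p)\to_{\mathcal F}(S'_{\bar p'},p')$ between Segre varieties of generic rank equal to $m'=\dim_{\mathbb C}S'_{\bar p'}$.
   Context: Formal maps. Let $M\subset\mathbb C^n$, $M'\subset\mathbb C^{n'}$ be real analytic generic submanifolds of codimensions $d,d'\ge1$ and CR dimensions $m=n-d\ge1$, $m'=n'-d'\ge1$, and $p\in M$, $p'\in M'$. Choose holomorphic coordinates $t\in\mathbb C^n$, $t'\in\mathbb C^{n'}$ centered at $p$, $p'$ (so $p=0$, $p'=0$) and real analytic real-valued defining functions, $M=\{\rho(t,\bar t)=0\}$, $M'=\{\rho'(t',\bar t')=0\}$ near $0$, with $\rho=(\rho_1,\dots,\rho_d)$, $\partial\rho_1\wedge\cdots\wedge\partial\rho_d(0)\ne0$, $\rho'=(\rho'_1,\dots,\rho'_{d'})$, $\partial\rho'_1\wedge\cdots\wedge\partial\rho'_{d'}(0)\neq0$. The variable $\bar t$ is complexified to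 an independent variable $\tau\in\mathbb C^n$; for a power series $a(t)=\sum a_\gamma t^\gamma$ put $\bar a(\tau)=\sum\overline{a_\gamma}\tau^\gamma$. A formal holomorphic map $h:(\mathbb C^n,p)\to(\mathbb C^{n'},p')$ is an $n'$-tuple of formal power series in $t$ with $h(0)=0$ (in these centered coordinates). It maps $(M,p)$ formally into $(M',p')$, written $h:(M,p)\to_{\mathcal F}(M',p')$, if there is a $d'\times d$ matrix $\mu(t,\tau)$ of formal power series with $\rho'(h(t),\bar h(\tau))\equiv\mu(t,\tau)\,\rho(t,\tau)$. Segre varieties. $S_{\bar p}=\{t:\rho(t,0)=0\}$ and $S'_{\bar p'}=\{t':\rho'(t',0)=0\}$ are germs of complex submanifolds of dimensions $m$ and $m'$. Since $\rho'(h(t),0)=0$ when $\rho(t,0)=0$, $h$ induces a formal holomorphic map $(S_{\bar p},p)\to_{\mathcal F}(S'_{\bar p'},p')$. It has (formal) generic rank $m'$ if, in local charts, some $m'\times m'$ minor of its formal Jacobian matrix does not vanish identically as a formal power series. S-nondegeneracy. Renumber coordinates so that $\det(\partial\rho_j/\partial t_k(0))_{1\le j\le d,\ m+1\le k\le n}\neq0$, and let $\underline{\mathcal L}_j=\partial/\partial\tau_j-\sum_{k=m+1}^n b_{j,k}(t,\tau)\,\partial/\partial\tau_k$, $1\le j\le m$, be the unique vector fields of this form with convergent coefficients such that $\underline{\mathcal L}_j\rho_l(t,\tau)\equiv0$ for all $l$. For $\gamma\in\mathbb N^m$ put $\underline{\mathcal L}^\gamma=\underline{\mathcal L}_1^{\gamma_1}\cdots\underline{\mathcal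 L}_m^{\gamma_m}$. Let $\nabla^{\kappa}\bar h(\tau)=(\partial_\tau^\alpha\bar h(\tau))_{|\alpha|\le\kappa}$. There are holomorphic maps $R'_\gamma=(R'^{\,1}_\gamma,\dots,R'^{\,d'}_\gamma)$ near $(0,0,0,\nabla^{|\gamma|}\bar h(0))$ with $\underline{\mathcal L}^\gamma[\rho'(t',\bar h(\tau))]=R'_\gamma(t,\tau,t',\nabla^{|\gamma|}\bar h(\tau))$, where $t'$ is regarded as independent of $\tau$. Let $w\mapsto\varphi(w)$, $\varphi(0)=0$, $w\in\mathbb C^m$, be a local holomorphic parametrization of $S_{\bar p}$. The formal map $h$ is S-nondegenerate at $p$ if there exist $\gamma_1,\dots,\gamma_{n'}\in\mathbb N^m$ and $l_1,\dots,l_{n'}\in\{1,\dots,d'\}$ with $$\det\Big(\frac{\partial R'^{\,l_j}_{\gamma_j}}{\partial t'_k}\big(\varphi(w),0,h(\varphi(w)),\nabla^{|\gamma_j|}\bar h(0)\big)\Big)_{1\le j,k\le n'}\not\equiv0\ \text{ in }\mathbb C[[w]].$$ This does not depend on the choices made. A real analytic generic submanifold $M'$ is S-nondegenerate at $p'$ if the identity map $(M',p')\to_{\mathcal F}(M',p')$ is S-nondegenerate at $p'$. *)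

(* Defs.v *)
(* A formal power series over a commutative ring K in variables
   indexed by a finite type I is its coefficient function on multi-exponents. *)
From HB Require Import structures.
From mathcomp Require Import all_boot all_order all_fingroup all_algebra.
From mathcomp Require Import boolp classical_sets reals complex.
Set Implicit Arguments.
Unset Strict Implicit.
Unset Printing Implicit Defensive.
Import Order.TTheory GRing.Theory Num.Theory.
Local Open Scope ring_scope.

Definition mexp (I : finType) := {ffun I -> nat}.

Section Exponents.
Variable I : finType.
Implicit Types g b : mexp I.

Definition mexp0 : mexp I := [ffun=> 0%N].
Definition mexp1 (i : I) : mexp I := [ffun j => (j == i : nat)].
Definition mexpD g b : mexp I := [ffun i => (g i + b i)%N].
Definition mexpB g b : mexp I := [ffun i => (g i - b i)%N].
Definition mexp_le b g := [forall i, (b i <= g i)%N].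
Definition mdeg g : nat := (\sum_i g i)%N.

(* the exponents b with b i <= g i for all i, each listed once *)
Definition below g : seq (mexp I) :=
  [seq [ffun i => nat_of_ord (k i)] | k : {dffun forall i, 'I_(g i).+1}].

Definition box (N : nat) : seq (mexp I) := below [ffun=> N].

Lemma mem_below g b : (b \in below g) = mexp_le b g.
Proof.
apply/mapP/forallP => [[k _ ->] i|lebg].
  by rewrite ffunE -ltnS.
exists [ffun i => @Ordinal (g i).+1 (b i) (lebg i)]; first by rewrite mem_enum.
by apply/ffunP => i; rewrite !ffunE.
Qed.

Lemma below_uniq g : uniq (below g).
Proof.
rewrite map_inj_uniq ?enum_uniq // => k k' /ffunP eqk.
by apply/ffunP => i; apply/val_inj; have := eqk i; rewrite !ffunE.
Qed.

Lemma mexpBK g b : mexp_le b g -> mexpB g (mexpB g b) = b.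
Proof. by move=> /forallP le; apply/ffunP => i; rewrite !ffunE subKn. Qed.

Lemma mexpB_le g b : mexp_le (mexpB g b) g.
Proof. by apply/forallP => i; rewrite ffunE leq_subr. Qed.

End Exponents.

Definition fps (I : finType) (K : Type) := mexp I -> K.

Section Ring.
Variables (I : finType) (K : comNzRingType).
Implicit Types a b c : fps I K.

HB.instance Definition _ := gen_eqMixin (fps I K).
HB.instance Definition _ := gen_choiceMixin (fps I K).

Definition fps_zero : fps I K := fun=> 0.
Definition fps_opp a : fps I K := fun g => - a g.
Definition fps_add a b : fps I K := fun g => a g + b g.
Definition fps_one : fps I K := fun g => (g == mexp0 I)%:R.
Definition fps_mul a b : fps I K :=
  fun g => \sum_(d <- below g) a d * b (mexpB g d).

Fact fps_addA : associative fps_add.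
Proof. by move=> a b c; apply/funext => g; exact: addrA. Qed.
Fact fps_addC : commutative fps_add.
Proof. by move=> a b; apply/funext => g; exact: addrC. Qed.
Fact fps_add0 : left_id fps_zero fps_add.
Proof. by move=> a; apply/funext => g; exact: add0r. Qed.
Fact fps_addN : left_inverse fps_zero fps_opp fps_add.
Proof. by move=> a; apply/funext => g; exact: addNr. Qed.

HB.instance Definition _ :=
  GRing.isZmodule.Build (fps I K) fps_addA fps_addC fps_add0 fps_addN.

Fact fps_mulC : commutative fps_mul.
Proof.
move=> a b; apply/funext => g; rewrite /fps_mul.
have pe : perm_eq (below g) [seq mexpB g d | d <- below g].
  apply: uniq_perm; rewrite ?below_uniq //.
    rewrite map_inj_in_uniq ?below_uniq // => d d'.
    rewrite !mem_below => led led' /(congr1 (mexpB g)).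
    by rewrite !mexpBK.
  move=> d; apply/idP/mapP => [|[e _ ->]].
    rewrite mem_below => led; exists (mexpB g d); last by rewrite mexpBK.
    by rewrite mem_below mexpB_le.
  by rewrite mem_below mexpB_le.
rewrite (perm_big _ pe) /= big_map; apply: eq_big_seq => d.
by rewrite mem_below => led; rewrite mexpBK // mulrC.
Qed.

Fact fps_mul1 : left_id fps_one fps_mul.
Proof.
move=> a; apply/funext => g; rewrite /fps_mul /fps_one.
have in0 : mexp0 I \in below g.
  by rewrite mem_below; apply/forallP => i; rewrite ffunE.
rewrite (bigD1_seq _ in0) ?below_uniq //= eqxx mul1r big1 => [|d /negbTE->].
  by rewrite addr0; congr a; apply/ffunP => i; rewrite !ffunE subn0.
by rewrite mul0r.
Qed.

Fact fps_mulD : left_distributive fps_mul fps_add.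
Proof.
move=> a b c; apply/funext => g; rewrite /fps_mul /fps_add -big_split /=.
by apply: eq_bigr => d _; rewrite mulrDl.
Qed.

Fact fps_mulA : associative fps_mul.
Proof.
move=> a b c; apply/funext => g; rewrite /fps_mul.
have trans d e : mexp_le d e -> mexp_le e g -> mexp_le d g.
  move=> /forallP le1 /forallP le2; apply/forallP => i.
  exact: leq_trans (le1 i) (le2 i).
transitivity (\sum_(e <- below g) \sum_(d <- below g | mexp_le e d)
    a e * b (mexpB d e) * c (mexpB g d)).
  apply: eq_big_seq => e; rewrite mem_below => leg; rewrite big_distrr /=.
  have pe : perm_eq [seq d <- below g | mexp_le e d]
                    [seq mexpD e d | d <- below (mexpB g e)].
    apply: uniq_perm; rewrite ?filter_uniq ?below_uniq //.
      rewrite map_inj_uniq ?below_uniq // => d d' /ffunP eqd.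
      apply/ffunP => i; have := eqd i; rewrite !ffunE.
      by move/eqP; rewrite eqn_add2l => /eqP.
    move=> d; rewrite mem_filter mem_below; apply/andP/mapP.
      move=> [/forallP led /forallP ldg]; exists (mexpB d e); last first.
        by apply/ffunP => i; rewrite !ffunE subnKC.
      by rewrite mem_below; apply/forallP => i; rewrite !ffunE leq_sub2r.
    move=> [f]; rewrite mem_below => /forallP lef ->; split; apply/forallP => i.
      by rewrite ffunE leq_addr.
    have /forallP/(_ i) leg' := leg.
    by have := lef i; rewrite !ffunE -(leq_add2l (e i)) subnKC.
  rewrite -[RHS]big_filter (perm_big _ pe) [RHS]big_map; apply: eq_bigr => d _.
  rewrite mulrA; congr (_ * b _ * c _); apply/ffunP => i.
    by rewrite !ffunE addKn.
  by rewrite !ffunE subnDA.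
rewrite (exchange_big_dep xpredT) //=; apply: eq_big_seq => d.
rewrite mem_below => ldg; rewrite big_distrl /= -big_filter.
apply: perm_big; apply: uniq_perm; rewrite ?filter_uniq ?below_uniq // => e.
rewrite mem_filter !mem_below; apply/andP/idP => [[]//|led].
by split=> //; exact: trans led ldg.
Qed.

Fact fps_1neq0 : fps_one != 0 :> fps I K.
Proof.
apply/eqP => /(congr1 (fun f : fps I K => f (mexp0 I))) /eqP.
by rewrite /fps_one eqxx (oner_eq0 K).
Qed.

HB.instance Definition _ := GRing.Zmodule_isComNzRing.Build (fps I K)
  fps_mulA fps_mulC fps_mul1 fps_mulD fps_1neq0.

Definition fpsX (i : I) : fps I K := fun g => (g == mexp1 i)%:R.

Definition coef0 a : K := a (mexp0 I).

Definition pder (i : I) a : fps I K :=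
  fun g => a (mexpD g (mexp1 i)) *+ (g i).+1.

End Ring.

Arguments fpsX {I K} i.

Section Substitution.
Variables (I J : finType) (K : comNzRingType).

(* The substitution a(u), meaningful when every u i has zero constant term:
   only the exponents of degree at most mdeg g then contribute to the
   coefficient of index g, so that the finite sum below is the full one. *)
Definition fps_subst (a : fps I K) (u : I -> fps J K) : fps J K :=
  fun g => \sum_(d <- box I (mdeg g)) a d * (\prod_i u i ^+ d i) g.

End Substitution.

Definition jac0 (K : comNzRingType) (p q : nat) (f : 'I_p -> fps 'I_q K) :
    'M[K]_(p, q) :=
  \matrix_(i, k) coef0 (pder k (f i)).

Section Analysis.
Variables (R : realType) (I : finType).
Local Notation K := R[i].

Definition convergent (a : fps I K) :=
  exists C r : K, 0 < r /\ forall g, `|a g| * r ^+ mdeg g <= C.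

(* the power series a, summed at the point x, has sum v *)
Definition sums_to (a : fps I K) (x : I -> K) (v : K) :=
  forall e : K, 0 < e -> exists N0 : nat, forall N : nat, (N0 <= N)%N ->
    `|\sum_(g <- box I N) a g * \prod_i x i ^+ g i - v| < e.

Definition fps_conj (a : fps I K) : fps I K := fun g => (a g)^*.

End Analysis.

(* The variables (t, tau), where t = inl and tau = inr. *)
Notation tvars n := ('I_n + 'I_n)%type.

Section Manifolds.
Variable R : realType.
Local Notation K := R[i].

Definition swap_exp n (g : mexp (tvars n)) : mexp (tvars n) :=
  [ffun v => g (match v with inl k => inr k | inr k => inl k end)].

(* A convergent series a(t, tau) represents the germ a(t, conj t); this germ is
   real-valued when the coefficients of t^al tau^be and t^be tau^al are
   conjugate, i.e. when conj a (tau, t) = a (t, tau). *)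
Definition real_valued n (a : fps (tvars n) K) :=
  forall g, a (swap_exp g) = (a g)^*.

(* (z - p, conj (z - p)) *)
Definition tpoint n (p z : 'rV[K]_n) (v : tvars n) : K :=
  match v with
  | inl k => z 0 k - p 0 k
  | inr k => (z 0 k - p 0 k)^*
  end.

(* rho_1, ..., rho_d are real analytic real-valued defining functions, with
   d rho_1 ^ ... ^ d rho_d (0) <> 0 for the (1,0)-part of the differential, of M
   near p, in the coordinates t = z - p centered at p. *)
Definition defining_functions n d (M : set 'rV[K]_n) (p : 'rV[K]_n)
    (rho : 'I_d -> fps (tvars n) K) :=
  [/\ forall j, convergent (rho j),
      forall j, real_valued (rho j),
      forall j, coef0 (rho j) = 0,
      row_free (\matrix_(j < d, k < n) coef0 (pder (inl k) (rho j))) &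
      exists2 e : K, 0 < e &
        forall z : 'rV[K]_n, (forall k, `|z 0 k - p 0 k| < e) ->
          (M z <-> forall j, sums_to (rho j) (tpoint p z) 0)].

(* real analytic generic submanifolds of C^(m + d), of CR dimension m and
   codimension d *)
Definition generic_submanifold m d (M : set 'rV[K]_(m + d)) :=
  forall p, M p ->
    exists rho : 'I_d -> fps (tvars (m + d)) K, defining_functions M p rho.

Definition at_tau0 n (a : fps (tvars n) K) : fps 'I_n K :=
  fps_subst a (fun v => match v with inl k => fpsX k | inr _ => 0 end).

(* The choices needed to define S-nondegeneracy:
   - defining functions rho of M at p;
   - a renumbering numb of the coordinates, the j-th coordinate (j < m) becoming
     numb (lshift d j) and the (m + k)-th one becoming numb (rshift m k);
   - the coefficients vfc of the vector fields
       L_j = d/dtau_j - \sum_k vfc_(j,k)(t,tau) d/dtau_(m+k),  L_j rho_l = 0;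
   - a local holomorphic parametrization phi of {t | rho(t,0) = 0}, which has
     dimension m. *)
Record frame m d (M : set 'rV[K]_(m + d)) (p : 'rV[K]_(m + d)) := Frame {
  rho : 'I_d -> fps (tvars (m + d)) K;
  rho_def : defining_functions M p rho;
  numb : {perm 'I_(m + d)};
  numb_det : \det (\matrix_(j < d, k < d)
    coef0 (pder (inl (numb (rshift m k))) (rho j))) != 0;
  vfc : 'I_m -> 'I_d -> fps (tvars (m + d)) K;
  vfc_conv : forall j k, convergent (vfc j k);
  vfc_tangent : forall j l,
    pder (inr (numb (lshift d j))) (rho l)
    - \sum_k vfc j k * pder (inr (numb (rshift m k))) (rho l) = 0;
  phi : 'I_(m + d) -> fps 'I_m K;
  phi_conv : forall i, convergent (phi i);
  phi0 : forall i, coef0 (phi i) = 0;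
  phi_segre : forall j, fps_subst (at_tau0 (rho j)) phi = 0;
  phi_rank : \rank (jac0 phi) = m }.

Section Maps.
Variables (m d m' d' : nat).
Variables (M : set 'rV[K]_(m + d)) (p : 'rV[K]_(m + d)) (F : frame M p).
Variables (M' : set 'rV[K]_(m' + d')) (p' : 'rV[K]_(m' + d')).
Variable F' : frame M' p'.

(* An n'-tuple h of series in t stands for the map p + t |-> p' + h(t). *)
Variable h : 'I_(m' + d') -> fps 'I_(m + d) K.

(* rho'_l (h(t), conj h (tau)) *)
Definition pullback (l : 'I_d') : fps (tvars (m + d)) K :=
  fps_subst (rho F' l) (fun v => match v with
    | inl k => fps_subst (h k) (fun i => fpsX (inl i))
    | inr k => fps_subst (fps_conj (h k)) (fun i => fpsX (inr i))
    end).

Definition formal_map :=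
  (forall k, coef0 (h k) = 0) /\
  exists mu : 'M[fps (tvars (m + d)) K]_(d', d),
    forall l, pullback l = \sum_j mu l j * rho F j.

(* The variables (t, tau, t'), where t' is independent of (t, tau). *)
Let vars3 : finType := (tvars (m + d) + 'I_(m' + d'))%type.

Definition vf (j : 'I_m) (f : fps vars3 K) : fps vars3 K :=
  pder (inl (inr (numb F (lshift d j)))) f
  - \sum_k fps_subst (vfc F j k) (fun v => fpsX (inl v))
      * pder (inl (inr (numb F (rshift m k)))) f.

(* L^g = L_1^(g_1) ... L_m^(g_m) *)
Definition vf_pow (g : mexp 'I_m) (f : fps vars3 K) : fps vars3 K :=
  foldr (fun j => iter (g j) (vf j)) f (enum 'I_m).

(* rho'_l (t', conj h (tau)) *)
Definition rho_conj (l : 'I_d') : fps vars3 K :=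
  fps_subst (rho F' l) (fun v => match v with
    | inl k => fpsX (inr k)
    | inr k => fps_subst (fps_conj (h k)) (fun i => fpsX (inl (inr i)))
    end).

(* R'^l_g (t, tau, t', jet of conj h at tau), a series in (t, tau, t'). *)
Definition jet_fun (g : mexp 'I_m) (l : 'I_d') : fps vars3 K :=
  vf_pow g (rho_conj l).

Definition along_segre (f : fps vars3 K) : fps 'I_m K :=
  fps_subst f (fun v => match v with
    | inl (inl i) => phi F i
    | inl (inr _) => 0
    | inr k => fps_subst (h k) (phi F)
    end).

(* At tau = 0 the last argument of R'^l_g is the jet of conj h at 0. As R'^l_g
   depends on t' only through its third argument, the series
   (d R'^l_g / d t'_k)(phi(w), 0, h(phi(w)), jet of conj h at 0)
   is d/dt'_k (jet_fun g l) taken at t = phi(w), tau = 0, t' = h(phi(w)). *)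
Definition S_nondegenerate :=
  exists (g : 'I_(m' + d') -> mexp 'I_m) (l : 'I_(m' + d') -> 'I_d'),
    \det (\matrix_(j, k) along_segre (pder (inr k) (jet_fun (g j) (l j)))) != 0.

(* G is the expression, in the charts phi and phi', of the map induced by h
   between the Segre varieties. *)
Definition induced_segre_map (G : 'I_m' -> fps 'I_m K) :=
  (forall i, coef0 (G i) = 0) /\
  forall k, fps_subst (phi F' k) G = fps_subst (h k) (phi F).

(* some m' x m' minor of the Jacobian matrix does not vanish identically *)
Definition segre_generic_rank_max :=
  exists G : 'I_m' -> fps 'I_m K,
    induced_segre_map G /\
    exists c : 'I_m' -> 'I_m,
      \det (\matrix_(i, j) pder (c j) (G i)) != 0.

End Maps.

Definition manifold_S_nondegenerate m d (M : set 'rV[K]_(m + d))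
    (p : 'rV[K]_(m + d)) (F : frame M p) :=
  S_nondegenerate F F (fun k => fpsX k).

End Manifolds.

(* Main.v *)
(* Let psi = h o phi, with values in the Segre variety S' of M'.  With t = phi(w) and
   t' = psi(w) fixed, the fields L_j act on K[[w, tau]], and the series which vanish
   to infinite order along them at tau = 0 form a prime ideal P, stable under the
   L_j and containing the rho_l(phi(w), tau).  As h maps M into M', the derivations
   L_j of series in conj h (tau) are, modulo P, combinations of the fields L'_a
   taken at conj h (tau), with coefficient matrix (L_j conj h_a).  At w = 0 this
   matrix is governed by the conjugate of the map S -> S' induced by h, so generic
   rank m' gives it an m' x m' minor outside P.  Hence a relation over K[[w]] between the
   vectors defining the S-nondegeneracy of h is also a relation between those
   of M', taken along psi.  The latter span, because a series vanishing along psi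
   vanishes on S', again by generic rank m'.

   Working with tangential derivations and P replaces every use of the implicit
   function theorem, in particular for the lift of h o phi to the chart of S'. *)
Require Import Defs.
From HB Require Import structures.
From mathcomp Require Import all_boot all_order all_fingroup all_algebra.
From mathcomp Require Import boolp classical_sets reals complex.
Set Implicit Arguments.
Unset Strict Implicit.
Unset Printing Implicit Defensive.
Import Order.TTheory GRing.Theory Num.Theory.
Local Open Scope ring_scope.
Local Notation coef0 := Defs.coef0.

(** * Formal power series and substitution *)

(** P is useful because of two restrictions. At [tau = 0], a combination of series with coefficients
    [v] in K[[w]] lies in P exactly when [v] is a relation between all the vectors read off by the
    jets; this is how relations pass from the source to the target. At [w = 0], elements of P vanish
    along the conjugate Segre variety, the only place where the rank hypothesis can be tested.
    Primality serves to divide by a minor outside P in Cramer's rule. It comes from the Leibniz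
    formula, in characteristic zero. Stability of P under the fields rests on their commuting. The
    fields differentiate in [tau], so they see the conjugate Segre variety and [conj h]. The
    transfer is therefore stated over an abstract field with [xb] and [hb] as separate data, and
    complex conjugation returns only for actual frames. Both circumstances reduce to one condition:
    a nonzero m' x m' minor in the Jacobian of the free coordinates of h o phi. In (i) the series h
    o phi is an immersion into the Segre variety of M', hence is treated like a chart of it. *)

Section Exponents.
Variable I : finType.
Implicit Types d e g : mexp I.

Lemma mexp_le_refl g : mexp_le g g.
Proof. exact/forallP. Qed.

Lemma mdegD d e : mdeg (mexpD d e) = (mdeg d + mdeg e)%N.
Proof. by rewrite /mdeg -big_split /=; apply: eq_bigr => i _; rewrite ffunE. Qed.

Lemma mexp_leDl d e : mexp_le d (mexpD d e).
Proof. by apply/forallP => i; rewrite ffunE leq_addr. Qed.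

Lemma mexpDK d e : mexpB (mexpD d e) d = e.
Proof. by apply/ffunP => i; rewrite !ffunE addKn. Qed.

Lemma mexpBDK d g : mexp_le d g -> mexpD d (mexpB g d) = g.
Proof. by move=> /forallP le; apply/ffunP => i; rewrite !ffunE subnKC. Qed.

Lemma mexpDC d e : mexpD d e = mexpD e d.
Proof. by apply/ffunP => i; rewrite !ffunE addnC. Qed.

Lemma mexpDA d e g : mexpD d (mexpD e g) = mexpD (mexpD d e) g.
Proof. by apply/ffunP => i; rewrite !ffunE addnA. Qed.

Lemma mdeg1 i : mdeg (mexp1 i : mexp I) = 1%N.
Proof.
rewrite /mdeg (bigD1 i) //= big1 => [|j /negbTE ji]; rewrite ?ffunE ?eqxx //.
by rewrite ji.
Qed.

Lemma mdeg0 : mdeg (mexp0 I) = 0%N.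
Proof. by rewrite /mdeg big1 // => i _; rewrite ffunE. Qed.

Lemma mdeg_eq0 g : mdeg g = 0%N -> g = mexp0 I.
Proof.
move/eqP; rewrite /mdeg sum_nat_eq0 => /forallP g0; apply/ffunP => i.
by rewrite ffunE; apply/eqP/g0.
Qed.

Lemma leq_mdeg g i : (g i <= mdeg g)%N.
Proof. by rewrite /mdeg (bigD1 i) //= leq_addr. Qed.

Lemma mexp1_le g i : (0 < g i)%N -> mexp_le (mexp1 i) g.
Proof.
move=> gi; apply/forallP => j; rewrite ffunE.
by case: eqP => // ->.
Qed.

Lemma mem_box N g : (g \in box I N) = [forall i, (g i <= N)%N].
Proof.
by rewrite /box mem_below; apply: eq_forallb => i; rewrite ffunE.
Qed.

Lemma mdeg_box N g : (mdeg g <= N)%N -> g \in box I N.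
Proof.
by move=> le; rewrite mem_box; apply/forallP => i; exact: leq_trans (leq_mdeg g i) le.
Qed.

Lemma box_uniq N : uniq (box I N).
Proof. exact: below_uniq. Qed.

End Exponents.

Section Coefficients.
Variables (I : finType) (K : comNzRingType).
Implicit Types (a b : fps I K) (c : K).

Lemma fpsDE a b g : (a + b) g = a g + b g.
Proof. by []. Qed.

Lemma fpsNE a g : (- a) g = - a g.
Proof. by []. Qed.

Lemma fps0E g : (0 : fps I K) g = 0.
Proof. by []. Qed.

Lemma fpsME a b g : (a * b) g = \sum_(d <- below g) a d * b (mexpB g d).
Proof. by []. Qed.

Lemma fps_sumE (T : Type) (s : seq T) (Q : pred T) (F : T -> fps I K) g :
  (\sum_(t <- s | Q t) F t) g = \sum_(t <- s | Q t) F t g.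
Proof. by apply: (big_morph (fun a : fps I K => a g)). Qed.

Lemma fpsMnE a n g : (a *+ n) g = a g *+ n.
Proof. by elim: n => [|n IH]; rewrite ?mulr0n // !mulrS fpsDE IH. Qed.

Definition fpsC c : fps I K := fun g => if g == mexp0 I then c else 0.

Definition mono d : fps I K := fun g => (g == d)%:R.

Lemma mono_mul d a g : (mono d * a) g = if mexp_le d g then a (mexpB g d) else 0.
Proof.
rewrite fpsME /mono; case: ifP => [led|/negP nled].
  rewrite (bigD1_seq d) ?below_uniq ?mem_below //= eqxx mul1r big1 ?addr0 //.
  by move=> e /negbTE->; rewrite mul0r.
rewrite big_seq big1 // => e; rewrite mem_below => leg.
by case: eqP => [eqd|]; rewrite ?mul0r //; case: nled; rewrite -eqd.
Qed.

Lemma monoD d e : mono (mexpD d e) = mono d * mono e.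
Proof.
apply/funext => g; rewrite mono_mul /mono; case: ifP => [led|/negP nled].
  congr (nat_of_bool _)%:R; apply/eqP/eqP => [->|<-]; first by rewrite mexpDK.
  by rewrite mexpBDK.
by case: eqP nled => // -> []; exact: mexp_leDl.
Qed.

Lemma mono0 : mono (mexp0 I) = 1.
Proof. by []. Qed.

Lemma fpsC_mono c : fpsC c = fun g => c * mono (mexp0 I) g.
Proof.
by apply/funext => g; rewrite /fpsC /mono; case: eqP; rewrite ?mulr1 ?mulr0.
Qed.

Lemma fpsC_mul c a g : (fpsC c * a) g = c * a g.
Proof.
rewrite -[a in RHS]mul1r -mono0 !fpsME mulr_sumr.
by apply: eq_bigr => d _; rewrite fpsC_mono mulrA.
Qed.

Lemma fpsC1 : fpsC 1 = 1.
Proof. by apply/funext => g; rewrite fpsC_mono mul1r. Qed.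

Fact coef0_is_zmod : zmod_morphism (@coef0 I K).
Proof. by []. Qed.

Fact coef0_is_monoid : monoid_morphism (@coef0 I K).
Proof.
split=> [|a b]; first by rewrite /coef0 -mono0 /mono eqxx.
rewrite /coef0 fpsME big_seq.
rewrite (eq_bigr (fun d => if d == mexp0 I then a (mexp0 I) * b (mexp0 I) else 0)).
  have in0 : mexp0 I \in below (mexp0 I) by rewrite mem_below mexp_le_refl.
  rewrite -big_seq (bigD1_seq _ in0) ?below_uniq //= eqxx big1 ?addr0 //.
  by move=> d /negbTE->.
move=> d; rewrite mem_below => /forallP d0.
have -> : d = mexp0 I.
  by apply/ffunP => i; apply/eqP; have := d0 i; rewrite !ffunE leqn0.
rewrite eqxx; congr (_ * b _); apply/ffunP => i.
by rewrite !ffunE.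
Qed.

HB.instance Definition _ :=
  GRing.isZmodMorphism.Build (fps I K) K (coef0 (K:=K)) coef0_is_zmod.
HB.instance Definition _ :=
  GRing.isMonoidMorphism.Build (fps I K) K (coef0 (K:=K)) coef0_is_monoid.

Lemma coef0_fpsX i : coef0 (fpsX i : fps I K) = 0.
Proof.
rewrite /coef0 /fpsX; case: eqP => // /ffunP/(_ i).
by rewrite !ffunE eqxx.
Qed.

End Coefficients.

Arguments mono {I K} d.
Arguments fpsC {I K} c.

Section Order.
Variables (I : finType) (K : comNzRingType).
Implicit Types a b : fps I K.

(** Membership in the N-th power of the ideal of the variables. This filtration replaces the
    topology in every limit argument. *)
Definition vanish N a := forall g, (mdeg g < N)%N -> a g = 0.

Lemma vanishP a : (forall N, vanish N a) -> a = 0.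
Proof. by move=> va; apply/funext => g; apply: (va (mdeg g).+1). Qed.

Lemma vanish_leq M N a : (M <= N)%N -> vanish N a -> vanish M a.
Proof. by move=> le va g lt; apply: va; exact: leq_trans lt le. Qed.

Lemma vanishD N a b : vanish N a -> vanish N b -> vanish N (a + b).
Proof. by move=> va vb g lt; rewrite fpsDE va ?vb ?addr0. Qed.

Lemma vanishN N a : vanish N a -> vanish N (- a).
Proof. by move=> va g lt; rewrite fpsNE va ?oppr0. Qed.

Lemma vanishB N a b : vanish N a -> vanish N b -> vanish N (a - b).
Proof. by move=> va vb; apply/vanishD/vanishN. Qed.

Lemma vanish_sum N (T : Type) (s : seq T) (Q : pred T) (F : T -> fps I K) :
  (forall t, Q t -> vanish N (F t)) -> vanish N (\sum_(t <- s | Q t) F t).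
Proof. by move=> vF; elim/big_ind: _ => //; exact: vanishD. Qed.

Lemma vanishM M N a b : vanish M a -> vanish N b -> vanish (M + N) (a * b).
Proof.
move=> va vb g lt; rewrite fpsME big_seq big1 // => d; rewrite mem_below => led.
have degE : mdeg g = (mdeg d + mdeg (mexpB g d))%N by rewrite -mdegD mexpBDK.
have [ltd|ged] := ltnP (mdeg d) M; first by rewrite va ?mul0r.
rewrite [b _]vb ?mulr0 // -(ltn_add2l (mdeg d)) -degE.
by apply: (leq_trans lt); rewrite leq_add2r.
Qed.

Lemma vanishMl N a b : vanish N b -> vanish N (a * b).
Proof. by move=> vb; apply: (@vanishM 0%N). Qed.

Lemma vanish1 a : coef0 a = 0 -> vanish 1 a.
Proof. by move=> a0 g; rewrite ltnS leqn0 => /eqP/mdeg_eq0 ->. Qed.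

Lemma vanishX a n : coef0 a = 0 -> vanish n (a ^+ n).
Proof.
move=> a0; elim: n => [|n IH] //; rewrite exprS -add1n.
by apply: vanishM => //; exact: vanish1.
Qed.

Definition trunc N a : fps I K := \sum_(d <- box I N) fpsC (a d) * mono d.

Lemma truncE N a g : trunc N a g = if g \in box I N then a g else 0.
Proof.
rewrite /trunc fps_sumE; case: ifP => [gin|/negP gnin].
  rewrite (bigD1_seq g) ?box_uniq //= fpsC_mul /mono eqxx mulr1 big1 ?addr0 //.
  by move=> d /negbTE dg; rewrite fpsC_mul eq_sym dg mulr0.
rewrite big_seq big1 // => d din; rewrite fpsC_mul /mono.
by case: eqP => [eqd|]; rewrite ?mulr0 //; case: gnin; rewrite eqd.
Qed.

Lemma vanish_trunc N a : vanish N (a - trunc N a).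
Proof.
by move=> g lt; rewrite fpsDE fpsNE truncE mdeg_box ?subrr // ltnW.
Qed.

End Order.

(** Additive maps that lose at most [k] orders of vanishing are determined by their values on
    monomials: what a truncation at [N + k] omits is sent to order [N]. Substitutions use [k = 0],
    derivations [k = 1]. *)
Lemma continuous_ext (I J : finType) (K : comNzRingType)
    (f g : fps I K -> fps J K) (k : nat) :
  {morph f : a b / a + b} -> {morph g : a b / a + b} ->
  (forall N a, vanish (N + k) a -> vanish N (f a)) ->
  (forall N a, vanish (N + k) a -> vanish N (g a)) ->
  (forall c d, f (fpsC c * mono d) = g (fpsC c * mono d)) ->
  f =1 g.
Proof.
move=> fD gD fv gv fg a; apply/subr0_eq/vanishP => N.
have f0 : f 0 = 0 by apply: (addrI (f 0)); rewrite -fD !addr0.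
have g0 : g 0 = 0 by apply: (addrI (g 0)); rewrite -gD !addr0.
rewrite -(subrK (trunc (N + k) a) a) fD gD.
have -> : f (trunc (N + k) a) = g (trunc (N + k) a).
  rewrite /trunc; elim: (box _ _) => [|d s IH]; first by rewrite big_nil f0 g0.
  by rewrite big_cons fD gD fg IH.
rewrite opprD addrACA subrr addr0.
by apply: vanishB; [apply: fv|apply: gv]; exact: vanish_trunc.
Qed.

Section SubstitutionRing.
Variables (I J : finType) (K : comNzRingType).
Variable u : I -> fps J K.
Hypothesis u0 : forall i, coef0 (u i) = 0.
Implicit Types a b : fps I K.

Definition upow (d : mexp I) : fps J K := \prod_i u i ^+ d i.

Lemma upowD d e : upow (mexpD d e) = upow d * upow e.
Proof. by rewrite /upow -big_split /=; apply: eq_bigr => i _; rewrite ffunE exprD. Qed.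

Lemma vanish_upow d : vanish (mdeg d) (upow d).
Proof.
rewrite /upow /mdeg; elim/big_ind2: _ => //.
  by move=> m a n b; exact: vanishM.
by move=> i _; exact: vanishX.
Qed.

(** The box in [fps_subst] varies with the coefficient that is read. It may be enlarged at will,
    because an exponent outside it has degree above [mdeg g] and [upow d] vanishes to order
    [mdeg d]. *)
Lemma substE a N g : (mdeg g <= N)%N ->
  fps_subst a u g = \sum_(d <- box I N) a d * upow d g.
Proof.
move=> le; rewrite /fps_subst -/(upow _) [RHS](bigID (mem (box I (mdeg g)))) /=.
rewrite [X in _ + X]big1 ?addr0 => [|d].
  rewrite -[RHS]big_filter; apply: perm_big; apply: uniq_perm.
  - exact: box_uniq.
  - exact/filter_uniq/box_uniq.
  move=> d; rewrite mem_filter; apply/idP/andP => [din|[]//]; split=> //.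
  move: din; rewrite !mem_box => /forallP din; apply/forallP => i.
  exact: leq_trans (din i) le.
move=> dnin; rewrite vanish_upow ?mulr0 // ltnNge.
by apply: contra dnin; exact: mdeg_box.
Qed.

Lemma substD : {morph (fun a => fps_subst a u) : a b / a + b}.
Proof.
move=> a b; apply/funext => g; rewrite /fps_subst fpsDE -big_split /=.
by apply: eq_bigr => d _; rewrite -mulrDl.
Qed.

Lemma subst_fpsC_mul c a : fps_subst (fpsC c * a) u = fpsC c * fps_subst a u.
Proof.
apply/funext => g; rewrite fpsC_mul /fps_subst mulr_sumr.
by apply: eq_bigr => d _; rewrite fpsC_mul mulrA.
Qed.

Lemma subst_mono d : fps_subst (mono d) u = upow d.
Proof.
apply/funext => g; rewrite (substE _ (leq_addr (mdeg d) _)).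
rewrite (bigD1_seq d) ?box_uniq ?mdeg_box ?leq_addl //= /mono eqxx mul1r.
by rewrite big1 ?addr0 // => e /negbTE->; rewrite mul0r.
Qed.

Lemma vanish_subst N a : vanish N a -> vanish N (fps_subst a u).
Proof.
move=> va g lt; rewrite /fps_subst big1 // => d _.
have [ltd|ged] := ltnP (mdeg d) N; first by rewrite va ?mul0r.
by rewrite -/(upow d) vanish_upow ?mulr0 //; exact: leq_trans lt ged.
Qed.

Lemma substM : {morph (fun a => fps_subst a u) : a b / a * b}.
Proof.
move=> a b; rewrite /=; move: a.
apply: (continuous_ext (k := 0)).
- by move=> a c /=; rewrite mulrDl substD.
- by move=> a c /=; rewrite substD mulrDl.
- by move=> N a; rewrite addn0 => va; apply: vanish_subst; rewrite mulrC; exact: vanishMl.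
- by move=> N a; rewrite addn0 => va; rewrite mulrC; apply/vanishMl/vanish_subst.
move=> c d /=; rewrite -mulrA !subst_fpsC_mul -mulrA; congr (_ * _).
move: b; apply: (continuous_ext (k := 0)).
- by move=> a b /=; rewrite mulrDr substD.
- by move=> a b /=; rewrite substD mulrDr.
- by move=> N a; rewrite addn0 => va; apply: vanish_subst; exact: vanishMl.
- by move=> N a; rewrite addn0 => va; apply/vanishMl/vanish_subst.
move=> c' e; rewrite mulrCA !subst_fpsC_mul -monoD !subst_mono upowD.
by rewrite mulrCA.
Qed.

Lemma subst1 : fps_subst 1 u = 1.
Proof.
by rewrite -mono0 subst_mono /upow big1 // => i _; rewrite ffunE.
Qed.

Fact subst_is_zmod : zmod_morphism (fun a => fps_subst a u).
Proof.
move=> a b; apply: (addIr (fps_subst b u)); rewrite -substD !subrK //.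
Qed.

Fact subst_is_monoid : monoid_morphism (fun a => fps_subst a u).
Proof. by split; [exact: subst1|exact: substM]. Qed.

Definition subst_rm : {rmorphism fps I K -> fps J K} :=
  HB.pack (fun a => fps_subst a u)
    (GRing.isZmodMorphism.Build _ _ _ subst_is_zmod)
    (GRing.isMonoidMorphism.Build _ _ _ subst_is_monoid).

Lemma subst0 : fps_subst 0 u = 0.
Proof. exact: (rmorph0 subst_rm). Qed.

Lemma substB a b : fps_subst (a - b) u = fps_subst a u - fps_subst b u.
Proof. exact: (rmorphB subst_rm). Qed.

Lemma subst_sum (T : Type) (s : seq T) (Q : pred T) (F : T -> fps I K) :
  fps_subst (\sum_(t <- s | Q t) F t) u = \sum_(t <- s | Q t) fps_subst (F t) u.
Proof. exact: (rmorph_sum subst_rm). Qed.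

Lemma subst_det n (A : 'M[fps I K]_n) :
  fps_subst (\det A) u = \det (\matrix_(i, j) fps_subst (A i j) u).
Proof.
rewrite -[LHS]/(subst_rm _) -det_map_mx; congr (\det _).
by apply/matrixP => i j; rewrite !mxE.
Qed.

Lemma subst_fpsX i : fps_subst (fpsX i) u = u i.
Proof.
rewrite -[fpsX i]/(mono (mexp1 i)) subst_mono /upow (bigD1 i) //= ffunE eqxx expr1.
by rewrite big1 ?mulr1 // => j /negbTE ji; rewrite ffunE ji.
Qed.

Lemma coef0_subst a : coef0 (fps_subst a u) = coef0 a.
Proof.
rewrite {1}/coef0 (@substE a 0) ?mdeg0 //.
have in0 : mexp0 I \in box I 0 by rewrite mdeg_box ?mdeg0.
rewrite (bigD1_seq _ in0) ?box_uniq //= big_seq_cond big1 ?addr0.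
  rewrite -subst_mono mono0 subst1 -[X in _ * X]/(coef0 _) rmorph1 mulr1 //.
move=> d /andP[]; rewrite mem_box => /forallP d0 /eqP []; apply/ffunP => i.
by apply/eqP; rewrite ffunE -leqn0.
Qed.

End SubstitutionRing.

Section SubstitutionComp.
Variables (K : comNzRingType).

Lemma subst_comp (I J L : finType) (a : fps I K) (u : I -> fps J K)
    (v : J -> fps L K) :
  (forall i, coef0 (u i) = 0) -> (forall j, coef0 (v j) = 0) ->
  fps_subst (fps_subst a u) v = fps_subst a (fun i => fps_subst (u i) v).
Proof.
move=> u0 v0.
have uv0 i : coef0 (fps_subst (u i) v) = 0 by rewrite coef0_subst.
move: a; apply: (continuous_ext (k := 0)).
- by move=> a b; rewrite !substD.
- by move=> a b; rewrite !substD.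
- by move=> N a; rewrite addn0 => va; do 2 apply: vanish_subst => //.
- by move=> N a; rewrite addn0 => va; apply: vanish_subst.
move=> c d; rewrite !subst_fpsC_mul // !subst_mono //; congr (_ * _).
rewrite -[LHS]/(subst_rm v0 _) /upow rmorph_prod; apply: eq_bigr => i _.
by rewrite rmorphXn.
Qed.

(** Reduces multiplicative statements about monomials to the variables. The induction runs over
    duplicate-free lists of variables, with the exponent cut off outside the list. *)
Lemma mono_upow (I : finType) (d : mexp I) : mono d = upow (fun i => fpsX i) d :> fps I K.
Proof.
suff H s : uniq s -> \prod_(i <- s) (fpsX i : fps I K) ^+ d i
    = mono [ffun j => if j \in s then d j else 0%N].
  rewrite /upow H ?index_enum_uniq //; congr mono; apply/ffunP => j.
  by rewrite ffunE mem_index_enum.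
have Xn i n : (fpsX i : fps I K) ^+ n = mono [ffun j => if j == i then n else 0%N].
  elim: n => [|n IH].
    by rewrite expr0 -mono0; congr mono; apply/ffunP => j; rewrite !ffunE; case: eqP.
  rewrite exprS IH -[fpsX i]/(mono _) -monoD; congr mono; apply/ffunP => j.
  by rewrite !ffunE; case: eqP.
elim: s => [|i s IH] /=.
  by rewrite big_nil -mono0 => _; congr mono; apply/ffunP => j; rewrite !ffunE.
move=> /andP[nis us]; rewrite big_cons IH // Xn -monoD; congr mono.
apply/ffunP => j; rewrite !ffunE in_cons; case: eqP => [->|] //=.
by rewrite (negbTE nis) addn0.
Qed.

Lemma subst_id (I : finType) (a : fps I K) : fps_subst a (fun i => fpsX i) = a.
Proof.
have X0 i : coef0 (fpsX i : fps I K) = 0 by exact: coef0_fpsX.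
move: a; apply: (continuous_ext (k := 0)) => //.
- exact: substD.
- by move=> N a; rewrite addn0; exact: vanish_subst.
- by move=> N a; rewrite addn0.
by move=> c d; rewrite subst_fpsC_mul subst_mono // mono_upow.
Qed.

Lemma subst_zero (I J : finType) (a : fps I K) :
  fps_subst a (fun=> 0 : fps J K) = fpsC (coef0 a).
Proof.
have z0 i : coef0 ((fun _ : I => 0 : fps J K) i) = 0 by [].
move: a; apply: (continuous_ext (k := 0)) => //.
- exact: substD.
- by move=> a b; apply/funext => g; rewrite fpsDE /fpsC; case: eqP; rewrite ?addr0.
- by move=> N a; rewrite addn0; exact: vanish_subst.
- move=> N a; rewrite addn0 => va g lt; rewrite /fpsC; case: eqP => // g0.
  by apply: va; rewrite mdeg0; apply: leq_trans lt.
move=> c d; rewrite subst_fpsC_mul subst_mono //.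
apply/funext => g; rewrite fpsC_mul /coef0 /fpsC fpsC_mul /mono /upow.
have [<-|/eqP nd] := altP (mexp0 I =P d).
  by rewrite big1 ?mulr1 => [|i _]; rewrite ?ffunE ?expr0 // -mono0 /mono; case: eqP; rewrite ?mulr1 ?mulr0.
have [i di] : exists i, d i != 0%N.
  apply: contrapT => /forallNP d0; apply: nd; apply/ffunP => i; rewrite ffunE.
  by apply/esym/eqP/negPn/negP/d0.
by rewrite (bigD1 i) //= expr0n (negbTE di) mul0r fps0E mulr0; case: eqP.
Qed.

End SubstitutionComp.

(** * Derivations *)

Section PartialDerivatives.
Variables (I : finType) (K : comNzRingType).
Implicit Types a b : fps I K.

Lemma pder_coef i a g : pder i a g = a (mexpD g (mexp1 i)) *+ (g i).+1.
Proof. by []. Qed.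

Lemma pderD i : {morph @pder I K i : a b / a + b}.
Proof. by move=> a b; apply/funext => g; rewrite !pder_coef !fpsDE mulrnDl. Qed.

Lemma pder_fpsC_mul i c a : pder i (fpsC c * a) = fpsC c * pder i a.
Proof. by apply/funext => g; rewrite pder_coef !fpsC_mul mulrnAr. Qed.

Lemma vanish_pder i N a : vanish N.+1 a -> vanish N (pder i a).
Proof.
by move=> va g lt; rewrite pder_coef va ?mul0rn // mdegD mdeg1 addn1.
Qed.

Lemma pder_mono i d : pder i (mono d : fps I K) = mono (mexpB d (mexp1 i)) *+ d i.
Proof.
apply/funext => g; rewrite pder_coef fpsMnE /mono.
have [d0|d0] := posnP (d i).
  rewrite d0 mulr0n; case: eqP => [/ffunP/(_ i)|]; last by rewrite mul0rn.
  by rewrite !ffunE eqxx d0 addn1.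
have d1 := mexp1_le d0.
have -> : (mexpD g (mexp1 i) == d) = (g == mexpB d (mexp1 i)).
  by apply/eqP/eqP => [<-|->]; rewrite mexpDC ?mexpDK ?mexpBDK.
case: eqP => [->|]; last by rewrite !mul0rn.
by rewrite !ffunE eqxx subn1 prednK.
Qed.

Lemma pderM i a b : pder i (a * b) = pder i a * b + a * pder i b.
Proof.
move: a; apply: (continuous_ext (k := 1)).
- by move=> a c; rewrite mulrDl pderD.
- by move=> a c; rewrite pderD !mulrDl addrACA.
- by move=> N a; rewrite addn1 => va; apply: vanish_pder; rewrite mulrC; exact: vanishMl.
- move=> N a; rewrite addn1 => va; apply: vanishD; rewrite mulrC; apply: vanishMl.
    exact: vanish_pder.
  exact: vanish_leq va.
move=> c d; rewrite -mulrA !pder_fpsC_mul -!mulrA -mulrDr; congr (_ * _).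
move: b; apply: (continuous_ext (k := 1)).
- by move=> a b; rewrite mulrDr pderD.
- by move=> a b; rewrite pderD !mulrDr addrACA.
- by move=> N a; rewrite addn1 => va; apply: vanish_pder; exact: vanishMl.
- move=> N a; rewrite addn1 => va; apply: vanishD; apply: vanishMl.
    exact: vanish_leq va.
  exact: vanish_pder.
move=> c' e; rewrite mulrCA !pder_fpsC_mul !(mulrCA _ (fpsC c')) -mulrDr.
congr (_ * _); rewrite -monoD !pder_mono mulrnAl mulrnAr -!monoD ffunE mulrnDr.
congr (_ + _).
- have [->|d0] := posnP (d i); first by rewrite !mulr0n.
  congr (mono _ *+ _); rewrite -{1}(mexpBDK (mexp1_le d0)) -mexpDA mexpDK //.
- have [->|e0] := posnP (e i); first by rewrite !mulr0n.
  congr (mono _ *+ _); rewrite -{1}(mexpBDK (mexp1_le e0)).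
  by rewrite mexpDA [mexpD d _]mexpDC -mexpDA mexpDK.
Qed.

Lemma pder_comm i j a : pder i (pder j a) = pder j (pder i a).
Proof.
apply/funext => g; rewrite !pder_coef -!mulrnA.
have -> : mexpD (mexpD g (mexp1 i)) (mexp1 j) = mexpD (mexpD g (mexp1 j)) (mexp1 i).
  by rewrite -mexpDA [mexpD (mexp1 i) _]mexpDC mexpDA.
congr (_ *+ _); rewrite !ffunE (eq_sym j i).
by case: eqP => [->|_]; rewrite ?addn0 // mulnC.
Qed.

Lemma pder_fpsC i c : pder i (fpsC c : fps I K) = 0.
Proof.
apply/funext => g; rewrite pder_coef /fpsC; case: eqP => [/ffunP/(_ i)|].
  by rewrite !ffunE eqxx addn1.
by rewrite mul0rn.
Qed.

Lemma pder_fpsX i j : pder i (fpsX j : fps I K) = (i == j)%:R.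
Proof.
rewrite -[fpsX j]/(mono (mexp1 j)) pder_mono ffunE.
case: eqP => [->|_]; rewrite ?mulr0n // mulr1n -mono0; congr mono.
by apply/ffunP => k; rewrite !ffunE subnn.
Qed.

Lemma sum_pder_fpsX (T : finType) (f : T -> I) (a : T -> fps I K) t :
  injective f -> \sum_s a s * pder (f t) (fpsX (f s)) = a t.
Proof.
move=> f_inj; rewrite (bigD1 t) //= pder_fpsX eqxx mulr1 big1 ?addr0 // => s /negbTE st.
by rewrite pder_fpsX (inj_eq f_inj) eq_sym st mulr0.
Qed.

End PartialDerivatives.

Section Derivations.
Variables (J : finType) (K : comNzRingType).
Implicit Types (a b c : fps J K) (D : fps J K -> fps J K).

(** [vanish_der] is continuity: an algebraic derivation of a power series ring need not be
    determined by its values on the variables, and the chain rule would fail without it. *)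
Record derivation D : Prop := Derivation {
  derD : {morph D : a b / a + b};
  derM : forall a b, D (a * b) = D a * b + a * D b;
  der_fpsC : forall k : K, D (fpsC k) = 0;
  vanish_der : forall N a, vanish N.+1 a -> vanish N (D a) }.

Lemma pder_derivation j : derivation (@pder J K j).
Proof.
split; [exact: pderD|exact: pderM|exact: pder_fpsC|].
by move=> N a; exact: vanish_pder.
Qed.

Lemma derivationD D D' : derivation D -> derivation D' ->
  derivation (fun a => D a + D' a).
Proof.
move=> dD dD'; split=> [a b|a b|c|N a va].
- by rewrite (derD dD) (derD dD') addrACA.
- by rewrite (derM dD) (derM dD') mulrDl mulrDr addrACA.
- by rewrite (der_fpsC dD) (der_fpsC dD') addr0.
- by apply: vanishD; [apply: (vanish_der dD)|apply: (vanish_der dD')].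
Qed.

Lemma derivationZ c D : derivation D -> derivation (fun a => c * D a).
Proof.
move=> dD; split=> [a b|a b|k|N a va].
- by rewrite (derD dD) mulrDr.
- by rewrite (derM dD) mulrDr mulrA (mulrCA c).
- by rewrite (der_fpsC dD) mulr0.
- by apply: vanishMl; apply: (vanish_der dD).
Qed.

Lemma derivation0 : derivation (fun=> 0).
Proof. by split=> [a b|a b|c|N a va] //; rewrite ?mul0r ?mulr0 addr0. Qed.

Lemma derivation_sum (T : Type) (s : seq T) (F : T -> fps J K -> fps J K) :
  (forall t, derivation (F t)) -> derivation (fun a => \sum_(t <- s) F t a).
Proof.
move=> dF; elim: s => [|t s IH].
  under eq_fun do rewrite big_nil; exact: derivation0.
under eq_fun do rewrite big_cons; exact: derivationD.
Qed.

Lemma derivationN D : derivation D -> derivation (fun a => - D a).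
Proof. by move/(derivationZ (-1)); under eq_fun do rewrite mulN1r. Qed.

Section DerivationTheory.
Variable D : fps J K -> fps J K.
Hypothesis dD : derivation D.

Lemma der0 : D 0 = 0.
Proof. by apply: (addrI (D 0)); rewrite -(derD dD) !addr0. Qed.

Lemma der1 : D 1 = 0.
Proof. by rewrite -fpsC1 (der_fpsC dD). Qed.

Lemma derN a : D (- a) = - D a.
Proof. by apply: (addrI (D a)); rewrite -(derD dD) !subrr der0. Qed.

Lemma derB a b : D (a - b) = D a - D b.
Proof. by rewrite (derD dD) derN. Qed.

Lemma der_sum (T : Type) (s : seq T) (Q : pred T) (F : T -> fps J K) :
  D (\sum_(t <- s | Q t) F t) = \sum_(t <- s | Q t) D (F t).
Proof. apply: big_morph; [exact: derD dD | exact: der0]. Qed.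

(* Continuity reduces this to monomials, that is to products of variables. *)
Lemma chain_rule (I : finType) (u : I -> fps J K) (f : fps I K) :
  (forall i, coef0 (u i) = 0) ->
  D (fps_subst f u) = \sum_i fps_subst (pder i f) u * D (u i).
Proof.
move=> u0; move: f; apply: (continuous_ext (k := 1)).
- by move=> a b; rewrite substD (derD dD).
- move=> a b; rewrite -big_split /=; apply: eq_bigr => i _.
  by rewrite pderD substD mulrDl.
- by move=> N a; rewrite addn1 => va; apply: (vanish_der dD); apply: vanish_subst.
- move=> N a; rewrite addn1 => va; apply: vanish_sum => i _; rewrite mulrC.
  by apply/vanishMl/vanish_subst/vanish_pder.
move=> c d; rewrite subst_fpsC_mul (derM dD) (der_fpsC dD) mul0r add0r.
under eq_bigr do rewrite pder_fpsC_mul subst_fpsC_mul -mulrA.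
rewrite -mulr_sumr; congr (_ * _).
pose P (f : fps I K) := D (fps_subst f u) = \sum_i fps_subst (pder i f) u * D (u i).
have PM f g : P f -> P g -> P (f * g).
  rewrite /P => Pf Pg; rewrite substM // (derM dD) Pf Pg mulr_suml mulr_sumr -big_split.
  by apply: eq_bigr => i _; rewrite pderM substD !substM //= mulrDl mulrAC mulrA.
have PX i : P (fpsX i).
  rewrite /P subst_fpsX // (bigD1 i) //= pder_fpsX eqxx subst1 // mul1r big1 ?addr0 //.
  by move=> j /negbTE ji; rewrite pder_fpsX ji subst0 // mul0r.
have P1 : P 1.
  rewrite /P subst1 // der1 big1 // => i _.
  by rewrite -fpsC1 pder_fpsC subst0 // mul0r.
rewrite -/(P _) mono_upow /upow; elim/big_ind: _ => // i _.
by elim: (d i) => [|n IH]; rewrite ?expr0 // exprS; exact: PM.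
Qed.

End DerivationTheory.
End Derivations.

Section CharacteristicZero.
Variables (K : numDomainType).

Lemma fps_mulrSn_eq0 (I : finType) (a : fps I K) n : a *+ n.+1 = 0 -> a = 0.
Proof.
move=> a0; apply/funext => g; apply/eqP.
have : a g *+ n.+1 == 0 by rewrite -fpsMnE a0.
by rewrite mulrn_eq0.
Qed.

(** A coefficient of positive degree is, up to a positive integer factor, a coefficient of some
    partial derivative. This is the induction step whenever a series is shown to vanish to all
    orders. *)
Lemma vanish_integral (I : finType) (a : fps I K) N :
  coef0 a = 0 -> (forall i, vanish N (pder i a)) -> vanish N.+1 a.
Proof.
move=> a0 va g; rewrite ltnS => le.
have [->//|/eqP g0] := altP (g =P mexp0 I).
have [i gi] : exists i, (0 < g i)%N.
  apply: contrapT => /forallNP gz; apply: g0; apply/ffunP => i; rewrite ffunE.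
  by case: (posnP (g i)) => // /gz.
have gE := mexpBDK (mexp1_le gi); apply/eqP.
have : a g *+ (mexpB g (mexp1 i) i).+1 == 0.
  rewrite -{1}gE mexpDC -pder_coef; apply/eqP/(va i).
  by apply: leq_trans le; rewrite -{2}gE mdegD mdeg1.
by rewrite mulrn_eq0.
Qed.

End CharacteristicZero.

(** * Prime ideals defined by infinite-order vanishing *)

Section Ideals.
Variable A : comNzRingType.
Implicit Types (P : A -> Prop) (D : A -> A).

(* The unit ideal is allowed; ideal_mulrn says that the quotient is torsion-free. *)
Record prime_ideal P : Prop := PrimeIdeal {
  ideal0 : P 0;
  idealD : forall a b, P a -> P b -> P (a + b);
  idealM : forall a b, P b -> P (a * b);
  ideal_prime : forall a b, P (a * b) -> P a \/ P b;
  ideal_mulrn : forall a n, P (a *+ n.+1) -> P a }.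

Section IdealTheory.
Variable P : A -> Prop.
Hypothesis pP : prime_ideal P.

Lemma idealN a : P a -> P (- a).
Proof. by rewrite -mulN1r; exact: idealM. Qed.

Lemma idealB a b : P a -> P b -> P (a - b).
Proof. by move=> Pa Pb; apply: (idealD pP) => //; exact: idealN. Qed.

Lemma idealMr a b : P a -> P (a * b).
Proof. by rewrite mulrC; exact: idealM. Qed.

Lemma idealMn a n : P a -> P (a *+ n).
Proof. by rewrite -mulr_natl; exact: idealM. Qed.

Lemma ideal_sum (T : Type) (s : seq T) (Q : pred T) (F : T -> A) :
  (forall t, Q t -> P (F t)) -> P (\sum_(t <- s | Q t) F t).
Proof. by move=> PF; elim/big_ind: _ => //; [exact: ideal0|exact: idealD]. Qed.

(** Cramer's rule modulo P: the adjugate gives [\det N * x k] in P, and primality removes the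
    determinant. *)
Lemma ideal_linear_system n (N : 'M[A]_n) (x : 'I_n -> A) :
  ~ P (\det N) -> (forall l, P (\sum_k N l k * x k)) -> forall k, P (x k).
Proof.
move=> PN PNx k; suff : P (\det N * x k) by case/(ideal_prime pP).
have -> : \det N * x k = \sum_l \adj N k l * \sum_j N l j * x j.
  have := congr1 (fun B : 'M_n => (B *m \col_j x j) k 0) (mul_adj_mx N).
  rewrite mul_scalar_mx !mxE => <-.
  under [LHS]eq_bigr do rewrite !mxE mulr_suml.
  rewrite exchange_big /=; apply: eq_bigr => l _; rewrite mulr_sumr.
  by apply: eq_bigr => j _; rewrite mulrA.
by apply: ideal_sum => l _; apply: idealM.
Qed.

End IdealTheory.

Section Leibniz.
Variable D : A -> A.
Hypothesis DD : {morph D : a b / a + b}.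
Hypothesis DM : forall a b, D (a * b) = D a * b + a * D b.

Lemma iter_leibniz n a b :
  iter n D (a * b) =
  \sum_(i < n.+1) (iter i D a * iter (n - i) D b) *+ 'C(n, i).
Proof.
have D0 : D 0 = 0 by apply: (addrI (D 0)); rewrite -DD !addr0.
have Dn x k : D (x *+ k) = D x *+ k.
  by elim: k => [|k IH]; rewrite ?mulr0n // !mulrS DD IH.
elim: n => [|n IH]; first by rewrite big_ord1 /= bin0.
rewrite iterS IH (big_morph D DD D0).
under eq_bigr do rewrite Dn DM mulrnDl.
rewrite big_split /= [RHS]big_ord_recl /= bin0.
under [X in _ = _ + X]eq_bigr do rewrite /bump /= add1n subSS binS mulrnDr.
rewrite big_split /= addrA addrC; congr (_ + _).
rewrite big_ord_recl /= bin0 subn0 [in RHS]big_ord_recr /= bin_small // mulr0n addr0.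
congr (_ + _); apply: eq_bigr => i _.
by rewrite /= -[D (iter (n - _) D b)]iterS subnSK.
Qed.

(* If D^p a and D^q b are the first iterates outside P, the only term of the
   Leibniz formula for D^(p + q) (a b) outside P is the multiple
   of D^p a D^q b. *)
Lemma iter_prime_ideal P : prime_ideal P ->
  prime_ideal (fun a => forall n, P (iter n D a)).
Proof.
move=> pP.
have D0 : D 0 = 0 by apply: (addrI (D 0)); rewrite -DD !addr0.
have iD n a b : iter n D (a + b) = iter n D a + iter n D b.
  by elim: n => //= n ->; rewrite DD.
have iMn n a k : iter n D (a *+ k) = iter n D a *+ k.
  elim: k => [|k IH]; last by rewrite !mulrS iD IH.
  by rewrite !mulr0n; elim: n => //= n ->.
split.
- by move=> n; rewrite -(mulr0n 0) iMn mulr0n; exact: ideal0.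
- by move=> a b Pa Pb n; rewrite iD; exact: idealD.
- move=> a b Pb n; rewrite iter_leibniz; apply: ideal_sum => // i _.
  by apply: (idealMn pP); exact: (idealM pP).
- move=> a b Pab; apply: contrapT => /not_orP[/existsNP Pa /existsNP Pb].
  have ex (c : A) : (exists n, ~ P (iter n D c)) ->
      exists n, `[< ~ P (iter n D c) >] by case=> n Pn; exists n; apply/asboolP.
  case: (ex_minnP (ex a Pa)) => p /asboolP Pp minp.
  case: (ex_minnP (ex b Pb)) => q /asboolP Pq minq.
  have := Pab (p + q)%N; rewrite iter_leibniz.
  have ltp : (p < (p + q).+1)%N by rewrite ltnS leq_addr.
  rewrite (bigD1 (Ordinal ltp)) //= addKn => Psum.
  have : P ((iter p D a * iter q D b) *+ 'C(p + q, p)).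
    rewrite -[X in P X](addrK (\sum_(i < (p + q).+1 | i != Ordinal ltp)
      (iter i D a * iter (p + q - i) D b) *+ 'C(p + q, i))).
    apply: (idealB pP) Psum _; apply: (ideal_sum pP) => i.
    rewrite -val_eqE /= => nip; apply: (idealMn pP).
    (* Any other term has [i < p], or else [i > p] and so [p + q - i < q]; minimality of [p] or of
       [q] then puts one of its factors in P. *)
    have [lt|ge] := ltnP i p.
      apply: (idealMr pP); apply: contrapT => /asboolP/minp.
      by rewrite leqNgt lt.
    apply: (idealM pP); apply: contrapT => /asboolP/minq.
    rewrite leqNgt ltn_subLR; last by rewrite -ltnS ltn_ord.
    by rewrite ltn_add2r ltn_neqAle eq_sym nip ge.
  have : (0 < 'C(p + q, p))%N by rewrite bin_gt0 leq_addr.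
  case: 'C(_, _) => // c _ /(ideal_mulrn pP)/(ideal_prime pP).
  by case.
- by move=> a n Pan k; apply: (ideal_mulrn pP (n := n)); rewrite -iMn.
Qed.

End Leibniz.

Section JetIdeals.
Variables (I : finType) (D : I -> A -> A).
Hypothesis DD : forall i, {morph D i : a b / a + b}.
Hypothesis DM : forall i a b, D i (a * b) = D i a * b + a * D i b.

Definition jet (s : seq I) (g : mexp I) (a : A) : A :=
  foldr (fun j => iter (g j) (D j)) a s.

Definition jet_ideal P (s : seq I) (a : A) := forall g, P (jet s g a).

Lemma jet_eq (s : seq I) (g g' : mexp I) a :
  {in s, g =1 g'} -> jet s g a = jet s g' a.
Proof.
elim: s => //= i s IH gg'; rewrite gg' ?mem_head // IH // => j js.
by rewrite gg' // in_cons js orbT.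
Qed.

Lemma jet_mexp0 (s : seq I) a : jet s (mexp0 I) a = a.
Proof. by elim: s => //= i s ->; rewrite ffunE. Qed.

Lemma prime_ideal_ext P Q : (forall a, P a <-> Q a) -> prime_ideal P -> prime_ideal Q.
Proof. by move=> PQ; have -> : P = Q by apply/funext => a; apply/propext. Qed.

(** Each operator of the list adds one application of [iter_prime_ideal], starting from P. *)
Lemma jet_prime_ideal P s : uniq s -> prime_ideal P -> prime_ideal (jet_ideal P s).
Proof.
elim: s P => [|i s IH] P /=.
  by move=> _; apply: prime_ideal_ext => a; split=> [Pa g|/(_ (mexp0 I))].
move=> /andP[nis us] /(iter_prime_ideal (DD i) (DM i)) /(IH _ us).
apply: prime_ideal_ext => a; split=> [Pa g|Pa g n]; first exact: (Pa g (g i)).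
(* As [i] does not occur in [s], its exponent can be set to [n] without changing the inner jet. *)
have := Pa [ffun j => if j == i then n else g j]; rewrite /= ffunE eqxx.
rewrite (@jet_eq _ _ g) // => j js; rewrite ffunE; case: eqP => // ji.
by rewrite ji (negbTE nis) in js.
Qed.

Hypothesis Dcomm : forall i j a, D i (D j a) = D j (D i a).

Lemma jet_comm j s g a : D j (jet s g a) = jet s g (D j a).
Proof.
elim: s => //= i s <-; elim: (g i) => //= n <-; exact: Dcomm.
Qed.

(** Commutation lets the additional [D j] slide to its own factor, where it raises the exponent by
    one. The jet ideal is thus stable under every [D j]. *)
Lemma jet_der j s g a : uniq s -> j \in s ->
  jet s g (D j a) = jet s (mexpD g (mexp1 j)) a.
Proof.
elim: s => //= i s IH /andP[nis us]; rewrite in_cons => /predU1P[ji|js].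
  rewrite ji !ffunE eqxx addn1 -jet_comm -iterSr; congr (iter _ _ _).
  apply: jet_eq => k ks; rewrite !ffunE; case: eqP => [ki|_]; last by rewrite addn0.
  by rewrite -ki ks in nis.
rewrite IH // !ffunE; case: eqP => [ij|_]; last by rewrite addn0.
by rewrite ij js in nis.
Qed.

Lemma jet_ideal_der P j a : jet_ideal P (enum I) a -> jet_ideal P (enum I) (D j a).
Proof. by move=> Pa g; rewrite jet_der ?enum_uniq ?mem_enum. Qed.

End JetIdeals.
End Ideals.

Section VectorFieldBracket.
Variables (A : comNzRingType) (I : finType) (u v : A -> A) (w : I -> A -> A).
Variables (a b : I -> A) (D E : A -> A).
Hypothesis DE : forall x, D x = u x - \sum_k a k * w k x.
Hypothesis EE : forall x, E x = v x - \sum_k b k * w k x.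
Hypotheses (DD : {morph D : x y / x + y}) (ED : {morph E : x y / x + y}).
Hypothesis DM : forall x y, D (x * y) = D x * y + x * D y.
Hypothesis EM : forall x y, E (x * y) = E x * y + x * E y.
Hypotheses (uv : forall x, u (v x) = v (u x)) (uw : forall k x, u (w k x) = w k (u x)).
Hypotheses (vw : forall k x, v (w k x) = w k (v x)).
Hypothesis ww : forall k l x, w k (w l x) = w l (w k x).

(** Only derivatives of the coefficients survive, so the bracket has no component along [u] or
    [v]. *)
Lemma vector_field_bracket x :
  D (E x) - E (D x) = \sum_k w k x * (E (a k) - D (b k)).
Proof.
have morph0 (f : A -> A) : {morph f : x y / x + y} -> f 0 = 0.
  by move=> fD; apply: (addrI (f 0)); rewrite -fD !addr0.
have morphN (f : A -> A) y : {morph f : x y / x + y} -> f (- y) = - f y.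
  by move=> fD; apply: (addrI (f y)); rewrite -fD !subrr morph0.
have DEx : D (E x) = D (v x) - \sum_k D (b k) * w k x - \sum_k b k * D (w k x).
  rewrite EE DD morphN // (big_morph _ DD (morph0 _ DD)).
  under eq_bigr do rewrite DM; by rewrite big_split /= opprD addrA.
have EDx : E (D x) = E (u x) - \sum_k E (a k) * w k x - \sum_k a k * E (w k x).
  rewrite DE ED morphN // (big_morph _ ED (morph0 _ ED)).
  under eq_bigr do rewrite EM; by rewrite big_split /= opprD addrA.
(* The second-order parts of the two composites agree, by commutation of [u], [v] and the [w k]. *)
have sym : D (v x) - \sum_k b k * D (w k x) = E (u x) - \sum_k a k * E (w k x).
  rewrite DE EE uv.
  have -> : \sum_k b k * D (w k x)
      = \sum_k b k * u (w k x) - \sum_k \sum_l b k * (a l * w l (w k x)).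
    by rewrite -sumrB; apply: eq_bigr => k _; rewrite DE mulrBr mulr_sumr.
  have -> : \sum_k a k * E (w k x)
      = \sum_k a k * v (w k x) - \sum_k \sum_l a k * (b l * w l (w k x)).
    by rewrite -sumrB; apply: eq_bigr => k _; rewrite EE mulrBr mulr_sumr.
  have -> : \sum_k b k * u (w k x) = \sum_k b k * w k (u x).
    by apply: eq_bigr => k _; rewrite uw.
  have -> : \sum_k a k * v (w k x) = \sum_k a k * w k (v x).
    by apply: eq_bigr => k _; rewrite vw.
  have -> : \sum_k \sum_l b k * (a l * w l (w k x))
      = \sum_k \sum_l a k * (b l * w l (w k x)).
    rewrite exchange_big /=; apply: eq_bigr => k _; apply: eq_bigr => l _.
    by rewrite mulrCA ww.
  by rewrite !opprB addrACA [RHS]addrACA [- _ - _]addrC.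
under [RHS]eq_bigr do rewrite mulrC mulrBl.
rewrite sumrB DEx EDx [_ - _ - \sum_k b k * _]addrAC sym.
rewrite [_ - _ - \sum_k a k * E _ in X in _ - X]addrAC.
rewrite opprB [LHS]addrC; set z := E (u x) - _.
by rewrite addrA subrK.
Qed.

End VectorFieldBracket.

Lemma preim_prime_ideal (A B : comNzRingType) (f : {rmorphism A -> B}) (P : B -> Prop) :
  prime_ideal P -> prime_ideal (fun a => P (f a)).
Proof.
move=> pP; split=> [|a b Pa Pb|a b Pb|a b|a n].
- by rewrite rmorph0; exact: ideal0.
- by rewrite rmorphD; exact: idealD.
- by rewrite rmorphM; exact: idealM.
- by rewrite rmorphM; exact: ideal_prime.
- by rewrite rmorphMn /=; exact: ideal_mulrn.
Qed.

Lemma numDomain_prime_ideal (K : numDomainType) : prime_ideal (fun a : K => a = 0).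
Proof.
split=> [//|a b -> ->|a b ->|a b /eqP|a n /eqP].
- exact: addr0.
- exact: mulr0.
- by rewrite mulf_eq0 => /orP[]/eqP; [left|right].
- by rewrite mulrn_eq0 => /eqP.
Qed.

Section DomainInstance.
Variables (I : finType).

Section UnitRing.
Variable K : comNzRingType.

(** Units and inverses, taken by choice, serve to reach the integral domain structure, whose
    fraction field carries the linear algebra below. *)
Definition fps_unit : {pred fps I K} := fun a => `[< exists b, b * a = 1 >].

Definition fps_inv (a : fps I K) : fps I K :=
  if pselect (exists b, b * a = 1) is left e then projT1 (cid e) else a.

Fact fps_mulVr : {in fps_unit, left_inverse 1 fps_inv *%R}.
Proof.
move=> a /asboolP ua; rewrite /fps_inv; case: pselect => // e.
by case: (cid e).
Qed.

Fact fps_unitP (a b : fps I K) : b * a = 1 -> fps_unit a.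
Proof. by move=> ba1; apply/asboolP; exists b. Qed.

Fact fps_invr_out : {in [predC fps_unit], fps_inv =1 id}.
Proof.
move=> a ua; rewrite /fps_inv; case: pselect => [ex|//].
by case/negP: ua; apply/asboolP.
Qed.

HB.instance Definition _ := GRing.ComNzRing_hasMulInverse.Build (fps I K)
  fps_mulVr fps_unitP fps_invr_out.

End UnitRing.

(** The zero ideal is itself a jet ideal: start from the series with zero constant term, a prime
    ideal since K is a domain, and take the partial derivatives as operators. *)
Fact fps_mulf_eq0 (K : numDomainType) (a b : fps I K) :
  a * b = 0 -> (a == 0) || (b == 0).
Proof.
pose P := jet_ideal (@pder I K) (fun a => coef0 a = 0) (enum I).
have pP : prime_ideal P.
  apply: jet_prime_ideal; [exact: pderD|exact: pderM|exact: enum_uniq|].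
  exact: (preim_prime_ideal (coef0 (K := K)) (numDomain_prime_ideal K)).
have P0 c : P c -> c = 0.
  move=> Pc; apply: vanishP => N; elim: N c Pc => // N IH c Pc.
  apply: vanish_integral => [|i]; first by have := Pc (mexp0 I); rewrite jet_mexp0.
  apply: IH; apply: jet_ideal_der Pc; exact: pder_comm.
move=> ab0; have : P (a * b) by rewrite ab0; exact: ideal0.
by case/(ideal_prime pP) => /P0 ->; rewrite eqxx ?orbT.
Qed.

HB.instance Definition _ (K : numDomainType) :=
  GRing.ComUnitRing_isIntegral.Build (fps I K) (@fps_mulf_eq0 K).

End DomainInstance.

Lemma fps_prime_ideal (I : finType) (K : numDomainType) :
  prime_ideal (fun a : fps I K => a = 0).
Proof.
split=> [//|a b -> ->|a b ->|a b /eqP|a n].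
- exact: addr0.
- exact: mulr0.
- by rewrite mulf_eq0 => /orP[]/eqP; [left|right].
- exact: fps_mulrSn_eq0.
Qed.

(** * Linear algebra over a domain *)

Section LinearAlgebraOverDomain.
Variable B : idomainType.
Local Notation tofrac := (@FracField.tofrac B).

Lemma fractionP (x : {fraction B}) :
  exists a b : B, b != 0 /\ x * tofrac b = tofrac a.
Proof.
elim/quotW: x => r; exists \n_r, \d_r; split; first exact: denom_ratioP.
rewrite -[LHS]/(FracField.mul _ _) !piE; apply/eqmodP.
rewrite /= FracField.equivfE /FracField.mulf.
by rewrite !numden_Ratio ?(oner_eq0, mulf_neq0, denom_ratioP) // !mulr1 mulrC.
Qed.

Lemma common_denominator n (w : 'I_n -> {fraction B}) :
  exists (b : B) (a : 'I_n -> B), b != 0 /\ forall i, w i * tofrac b = tofrac (a i).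
Proof.
have /choice[num /choice[den nd]] := fun i => fractionP (w i).
exists (\prod_i den i), (fun i => num i * \prod_(j | j != i) den j); split=> [|i].
  by apply/prodf_neq0 => i _; case: (nd i).
by rewrite (bigD1 i) //= !rmorphM mulrA (nd i).2.
Qed.

(** The family [V] may be infinite. Independent rows are picked greedily over the fraction field; as
    long as fewer than [n] are chosen, some nonzero vector kills them all and, after clearing
    denominators, some member of the family does not kill it. *)
Lemma nonsingular_selection (T : Type) n (V : T -> 'I_n -> B) :
  (forall v : 'I_n -> B, (forall t, \sum_k V t k * v k = 0) -> forall k, v k = 0) ->
  exists s : 'I_n -> T, \det (\matrix_(j, k) V (s j) k) != 0.
Proof.
move=> Vinj.
suff [s] : exists s : 'I_n -> T, row_free (\matrix_(i < n, j < n) tofrac (V (s i) j)).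
  rewrite row_free_unit unitmxE unitfE => ds; exists s; apply: contra ds => /eqP ds.
  rewrite -(rmorph0 tofrac) -ds -det_map_mx; apply/eqP; congr (\det _).
  by apply/matrixP => i j; rewrite !mxE.
suff H k : (k <= n)%N ->
    exists s : 'I_k -> T, row_free (\matrix_(i < k, j < n) tofrac (V (s i) j)).
  exact: H.
elim: k => [_|k IH ltkn].
  have s0 (i : 'I_0) : T by case: i.
  by exists s0; apply: inj_row_free => v _; apply/rowP; case.
have [s] := IH (ltnW ltkn); set M := \matrix_(_, _) _ => freeM.
have [w w0 Mw] : exists2 w : 'cV_n, w != 0 & M *m w = 0.
  have : cokermx M != 0.
    by rewrite -mxrank_eq0 mxrank_coker (eqP freeM) subn_eq0 -ltnNge.
  case/matrix0Pn => i [j cij]; exists (col j (cokermx M)).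
    by apply/matrix0Pn; exists i, 0; rewrite mxE.
  by rewrite colE mulmxA mulmx_coker mul0mx.
have [b [a [b0 ab]]] := common_denominator (fun i => w i 0).
have [t Vt] : exists t, \sum_k V t k * a k != 0.
  apply: contrapT => /forallNP Va; case/negP: w0; apply/eqP/colP => i; rewrite mxE.
  have ai : a i = 0 by apply: Vinj => t; apply/eqP/negPn/negP/Va.
  move/eqP: (ab i); rewrite ai rmorph0 mulf_eq0 tofrac_eq0 (negbTE b0) orbF.
  by move/eqP.
rewrite -[k.+1]addn1.
exists (fun i => match split i with inl i => s i | inr _ => t end).
pose r := \row_j tofrac (V t j).
set N := \matrix_(_, _) _; have -> : N = col_mx M r.
  apply/matrixP => i j; rewrite !mxE; case: split => i'; by rewrite !mxE.
have rw : (r *m w) 0 0 != 0.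
  have : (r *m w) 0 0 * tofrac b != 0.
    rewrite mxE mulr_suml; under eq_bigr do rewrite mxE -mulrA ab -rmorphM.
    by rewrite -rmorph_sum tofrac_eq0.
  by apply: contraNneq => ->; rewrite mul0r.
(* Multiplying a relation by [w] kills the old rows and isolates the coefficient of the new one. *)
apply: inj_row_free => v; rewrite -[v]hsubmxK mul_row_col => Mr0.
have r0 : rsubmx v = 0.
  have := congr1 (fun u => u *m w) Mr0; rewrite mulmxDl -!mulmxA Mw mulmx0 add0r mul0mx.
  rewrite (mx11_scalar (r *m w)) mul_mx_scalar => /eqP.
  by rewrite scaler_eq0 (negbTE rw) => /eqP.
move: Mr0; rewrite r0 mul0mx addr0 -(mul0mx _ M) => /(row_free_inj freeM) ->.
exact: row_mx0.
Qed.

(** A nonzero determinant forces [Q] to have rank [k] over the fraction field, hence [k] independent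
    rows. *)
Lemma minor_of_product m k (P : 'M[B]_(k, m)) (Q : 'M[B]_(m, k)) :
  \det (P *m Q) != 0 -> exists f : 'I_k -> 'I_m, \det (rowsub f Q) != 0.
Proof.
rewrite -tofrac_eq0 -det_map_mx map_mxM -unitfE -unitmxE -row_full_unit => fPQ.
have fQ : row_full (map_mx tofrac Q).
  rewrite /row_full eqn_leq rank_leq_col -{1}(eqP fPQ); exact: mxrankM_maxr.
exists (fullrankfun fQ); rewrite -tofrac_eq0 -det_map_mx -unitfE -unitmxE.
have := fullrowsub_unit fQ; congr (_ \in unitmx).
by apply/matrixP => i j; rewrite !mxE.
Qed.

End LinearAlgebraOverDomain.

(** * Conjugation *)

Section Conjugation.
Variable R : realType.
Local Notation K := R[i].

Section OneIndex.
Variable I : finType.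
Implicit Types a b : fps I K.

Fact fps_conj_is_zmod : zmod_morphism (@fps_conj R I).
Proof.
by move=> a b; apply/funext => g; rewrite /fps_conj fpsDE fpsNE rmorphB.
Qed.

Fact fps_conj_is_monoid : monoid_morphism (@fps_conj R I).
Proof.
split=> [|a b]; apply/funext => g; first exact: rmorph_nat.
rewrite /fps_conj fpsME rmorph_sum; apply: eq_bigr => d _; exact: rmorphM.
Qed.

HB.instance Definition _ :=
  GRing.isZmodMorphism.Build (fps I K) (fps I K) (@fps_conj R I) fps_conj_is_zmod.
HB.instance Definition _ :=
  GRing.isMonoidMorphism.Build (fps I K) (fps I K) (@fps_conj R I) fps_conj_is_monoid.

Lemma fps_conjK : involutive (@fps_conj R I).
Proof. by move=> a; apply/funext => g; exact: conjCK. Qed.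

Lemma coef0_conj a : coef0 (fps_conj a) = (coef0 a)^*.
Proof. by []. Qed.

Lemma conj_fpsX i : fps_conj (fpsX i : fps I K) = fpsX i.
Proof. by apply/funext => g; exact: rmorph_nat. Qed.

Lemma conj_pder i a : fps_conj (pder i a) = pder i (fps_conj a).
Proof. by apply/funext => g; exact: rmorphMn. Qed.

Lemma conj_eq0 a : fps_conj a = 0 -> a = 0.
Proof. by move=> a0; rewrite -[a]fps_conjK a0 rmorph0. Qed.

End OneIndex.

Lemma conj_subst (I J : finType) (a : fps I K) (u : I -> fps J K) :
  fps_conj (fps_subst a u) = fps_subst (fps_conj a) (fun i => fps_conj (u i)).
Proof.
apply/funext => g; rewrite /fps_conj /fps_subst rmorph_sum /=.
apply: eq_bigr => d _; rewrite rmorphM /=; congr (_ * _).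
rewrite -[LHS]/(fps_conj _ g) rmorph_prod; congr ((_ : fps J K) g).
by apply: eq_bigr => i _; rewrite rmorphXn.
Qed.

Definition swap_var n (v : tvars n) : tvars n :=
  match v with inl k => inr k | inr k => inl k end.

Lemma swap_expK n : involutive (@swap_exp n).
Proof. by move=> g; apply/ffunP => -[k|k]; rewrite !ffunE. Qed.

Lemma subst_swap n (a : fps (tvars n) K) :
  fps_subst a (fun v => fpsX (swap_var v)) = fun g => a (swap_exp g).
Proof.
have X0 (v : tvars n) : coef0 (fpsX (swap_var v) : fps (tvars n) K) = 0.
  exact: coef0_fpsX.
move: a; apply: (continuous_ext (k := 0)) => //.
- exact: substD.
- by move=> N a; rewrite addn0; exact: vanish_subst.
- move=> N a; rewrite addn0 => va g lt; apply: va.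
  suff -> : mdeg (swap_exp g) = mdeg g by [].
  rewrite /mdeg !big_sumType /= addnC; congr (_ + _)%N.
    by apply: eq_bigr => k _; rewrite ffunE.
  by apply: eq_bigr => k _; rewrite ffunE.
move=> c d; rewrite subst_fpsC_mul subst_mono //; apply/funext => g.
rewrite !fpsC_mul; congr (_ * _).
have -> : upow (fun v : tvars n => fpsX (swap_var v)) d
    = mono (swap_exp d) :> fps (tvars n) K.
  rewrite mono_upow /upow !big_sumType /= mulrC.
  by congr (_ * _); apply: eq_bigr => k _; rewrite ffunE.
rewrite /mono; congr (nat_of_bool _)%:R.
by apply/eqP/eqP => [->|<-]; rewrite swap_expK.
Qed.

Lemma real_valued_conj n (a : fps (tvars n) K) :
  real_valued a -> fps_conj a = fps_subst a (fun v => fpsX (swap_var v)).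
Proof. by move=> ra; rewrite subst_swap; apply/funext => g; rewrite ra. Qed.

(** For real-valued series, conjugation exchanges the two groups of arguments; this is what carries
    the Segre variety to its conjugate. *)
Lemma conj_subst_real n (J : finType) (a : fps (tvars n) K) (u : tvars n -> fps J K) :
  real_valued a -> (forall v, coef0 (u v) = 0) ->
  fps_conj (fps_subst a u) = fps_subst a (fun v => fps_conj (u (swap_var v))).
Proof.
move=> ra u0.
have cu0 v : coef0 (fps_conj (u v)) = 0 by rewrite coef0_conj u0 rmorph0.
rewrite conj_subst real_valued_conj // subst_comp //; last by move=> v; exact: coef0_fpsX.
by congr fps_subst; apply/funext => v; rewrite subst_fpsX.
Qed.

Lemma coef0_pder_real n (a : fps (tvars n) K) (k : 'I_n) :
  real_valued a -> coef0 (pder (inr k) a) = (coef0 (pder (inl k) a))^*.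
Proof.
move=> ra; rewrite /coef0 !pder_coef !ffunE !mulr1n -ra; congr a.
by apply/ffunP => -[j|j]; rewrite !ffunE.
Qed.

End Conjugation.

Local Opaque fps_subst pder fps_mul fps_add fps_opp fps_one fps_zero fpsX.

(** * Tangential vector fields *)

Definition sumf (I J : Type) (T : Type) (x : I -> T) (y : J -> T) (v : I + J) : T :=
  match v with inl i => x i | inr j => y j end.

Section Embedding.
Variables (I J : finType) (K : comNzRingType).
Implicit Types a : fps I K.

Definition embl a : fps (I + J)%type K := fps_subst a (fun i => fpsX (inl i)).

Definition embr (b : fps J K) : fps (I + J)%type K :=
  fps_subst b (fun j => fpsX (inr j)).

Lemma coef0_embl a : coef0 (embl a) = coef0 a.
Proof. by rewrite coef0_subst // => i; exact: coef0_fpsX. Qed.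

Lemma coef0_embr b : coef0 (embr b) = coef0 b.
Proof. by rewrite coef0_subst // => i; exact: coef0_fpsX. Qed.

Lemma coef0_sumf (L : finType) (x : I -> fps L K) (y : J -> fps L K) :
  (forall i, coef0 (x i) = 0) -> (forall j, coef0 (y j) = 0) ->
  forall v, coef0 (sumf x y v) = 0.
Proof. by move=> x0 y0 []. Qed.

Section SubstEmbedding.
Variables (L : finType) (x : I -> fps L K) (y : J -> fps L K).
Hypotheses (x0 : forall i, coef0 (x i) = 0) (y0 : forall j, coef0 (y j) = 0).

Lemma subst_embl a : fps_subst (embl a) (sumf x y) = fps_subst a x.
Proof.
have xy0 := coef0_sumf x0 y0; rewrite subst_comp //; last by move=> i; exact: coef0_fpsX.
by congr fps_subst; apply/funext => i; rewrite subst_fpsX.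
Qed.

Lemma subst_embr b : fps_subst (embr b) (sumf x y) = fps_subst b y.
Proof.
have xy0 := coef0_sumf x0 y0; rewrite subst_comp //; last by move=> i; exact: coef0_fpsX.
by congr fps_subst; apply/funext => i; rewrite subst_fpsX.
Qed.

End SubstEmbedding.

Lemma der_embl (D : fps (I + J)%type K -> fps (I + J)%type K) a :
  derivation D -> (forall i, D (fpsX (inl i)) = 0) -> D (embl a) = 0.
Proof.
move=> dD D0; rewrite (chain_rule dD) => [|i]; last exact: coef0_fpsX.
by rewrite big1 // => i _; rewrite D0 mulr0.
Qed.

Lemma pder_inr_embl j a : pder (inr j) (embl a) = 0.
Proof. by apply: der_embl; [exact: pder_derivation|move=> i; rewrite pder_fpsX]. Qed.

End Embedding.

Arguments embl {I J K} a.
Arguments embr {I J K} b.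

(* The formal part of a frame, over an abstract field: the reality of rho is only
   remembered through defining_det_conj. *)
Record tangent_frame (K : numFieldType) (m d : nat) := TangentFrame {
  defining : 'I_d -> fps (tvars (m + d)) K;
  coord : {perm 'I_(m + d)};
  slope : 'I_m -> 'I_d -> fps (tvars (m + d)) K;
  defining_det : \det (\matrix_(l < d, k < d)
    coef0 (pder (inl (coord (rshift m k))) (defining l))) != 0;
  defining_det_conj : \det (\matrix_(l < d, k < d)
    coef0 (pder (inr (coord (rshift m k))) (defining l))) != 0;
  defining_tangent : forall j l,
    pder (inr (coord (lshift d j))) (defining l)
    - \sum_k slope j k * pder (inr (coord (rshift m k))) (defining l) = 0 }.

Section Frames.
Variables (K : numFieldType) (m d : nat) (F : tangent_frame K m d).
Local Notation n := (m + d)%N.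

Definition free_var (j : 'I_m) : 'I_n := coord F (lshift d j).
Definition dep_var (k : 'I_d) : 'I_n := coord F (rshift m k).

Lemma sum_frame (V : nmodType) (f : 'I_n -> V) :
  \sum_i f i = \sum_j f (free_var j) + \sum_k f (dep_var k).
Proof. by rewrite (reindex_perm (coord F)) big_split_ord. Qed.

Section AlongPoint.
Variables (J : finType) (theta : 'I_n -> fps J K).
Hypothesis theta0 : forall i, coef0 (theta i) = 0.

(* a(theta(w), tau), as a series in (w, tau) *)
Definition at_point (a : fps (tvars n) K) : fps (J + 'I_n)%type K :=
  fps_subst a (sumf (fun i => embl (theta i)) (fun i => fpsX (inr i))).

Lemma at_point_null v :
  coef0 (sumf (fun i => embl (theta i)) (fun i => fpsX (inr i) : fps (J + 'I_n)%type K) v) = 0.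
Proof. by case: v => i /=; rewrite ?coef0_embl ?coef0_fpsX. Qed.

Lemma pder_at_point i a : pder (inr i) (at_point a) = at_point (pder (inr i) a).
Proof.
rewrite (chain_rule (pder_derivation _ _)); last exact: at_point_null.
rewrite big_sumType /= big1 ?add0r => [|k _]; last by rewrite pder_inr_embl mulr0.
exact: (sum_pder_fpsX (f := inr) (fun k => at_point (pder (inr k) a)) i inr_inj).
Qed.

(* the field L_j at t = theta(w) *)
Definition tangent (j : 'I_m) (f : fps (J + 'I_n)%type K) : fps (J + 'I_n)%type K :=
  pder (inr (free_var j)) f
  - \sum_k at_point (slope F j k) * pder (inr (dep_var k)) f.

Lemma tangent_derivation j : derivation (tangent j).
Proof.
apply: derivationD; first exact: pder_derivation.
apply/derivationN/derivation_sum => k; apply/derivationZ; exact: pder_derivation.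
Qed.

Lemma tangent_inl j w : tangent j (fpsX (inl w)) = 0.
Proof. by rewrite /tangent pder_fpsX big1 ?subr0 // => k _; rewrite pder_fpsX mulr0. Qed.

Lemma tangent_embl j a : tangent j (embl a) = 0.
Proof. by apply: der_embl; [exact: tangent_derivation|exact: tangent_inl]. Qed.

Lemma tangent_rho j l : tangent j (at_point (defining F l)) = 0.
Proof.
have a0 := at_point_null.
transitivity (at_point (pder (inr (free_var j)) (defining F l)
    - \sum_k slope F j k * pder (inr (dep_var k)) (defining F l))).
  rewrite /tangent [in RHS]/at_point substB // subst_sum // pder_at_point.
  congr (_ - _); apply: eq_bigr => k _; rewrite pder_at_point.
  by rewrite substM.
by rewrite defining_tangent /at_point subst0.
Qed.

Section TangentChain.
Variables (L : finType) (alpha : J -> fps L K) (x : 'I_n -> fps L K).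
Hypotheses (alpha0 : forall j, coef0 (alpha j) = 0) (x0 : forall i, coef0 (x i) = 0).
Variables (D : fps L K -> fps L K) (P : fps L K -> Prop).
Hypotheses (dD : derivation D) (pP : prime_ideal P).
Hypothesis P_coef0 : forall a, P a -> coef0 a = 0.
Hypothesis D_alpha : forall j, D (alpha j) = 0.
Local Notation Xi f := (fps_subst f (sumf alpha x)).
Hypothesis P_rho : forall l, P (D (Xi (at_point (defining F l)))).

(* Modulo P, the derivation D is tangent to the fibres rho(theta, .) = 0, so its
   values on the dependent coordinates are determined by those on the free ones. *)
Lemma tangent_chain f :
  P (D (Xi f) - \sum_j Xi (tangent j f) * D (x (free_var j))).
Proof.
have ax0 := coef0_sumf alpha0 x0.
(* [y k] is the defect between the actual value of [D] on a dependent coordinate and the value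
   forced by tangency. Taking [g] to be a defining series in [main] gives a linear system for these
   defects modulo P. *)
pose y k := D (x (dep_var k)) + \sum_j Xi (at_point (slope F j k)) * D (x (free_var j)).
have main g : D (Xi g) - \sum_j Xi (tangent j g) * D (x (free_var j))
    = \sum_k Xi (pder (inr (dep_var k)) g) * y k.
  rewrite (chain_rule dD) // big_sumType /= big1 ?add0r => [|j _]; last first.
    by rewrite D_alpha mulr0.
  rewrite sum_frame.
  under [\sum_k Xi _ * y k]eq_bigr do rewrite mulrDr mulr_sumr.
  rewrite big_split /= [X in _ = _ + X]exchange_big /= addrAC addrC; congr (_ + _).
  rewrite -sumrB; apply: eq_bigr => j _.
  rewrite /tangent substB // subst_sum // mulrBl opprB addrCA subrr addr0 mulr_suml.
  by apply: eq_bigr => k _; rewrite substM // mulrCA mulrA.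
have yP k : P (y k).
  apply: (ideal_linear_system pP (N := \matrix_(l, k) Xi (pder (inr (dep_var k)) (at_point (defining F l))))).
    move/P_coef0; apply/eqP; rewrite -det_map_mx.
    have -> : map_mx (coef0 (K := K))
        (\matrix_(l, k) Xi (pder (inr (dep_var k)) (at_point (defining F l)))) =
        \matrix_(l, k) coef0 (pder (inr (dep_var k)) (defining F l)).
      apply/matrixP => l i; rewrite !mxE coef0_subst // pder_at_point coef0_subst //.
      exact: at_point_null.
    exact: (defining_det_conj F).
  move=> l; under eq_bigr do rewrite mxE; rewrite -main big1 ?subr0 // => j _.
  by rewrite tangent_rho subst0 // mul0r.
by rewrite main; apply: (ideal_sum pP) => k _; exact: idealM.
Qed.

End TangentChain.

Lemma tangent_bracket i j f :
  tangent i (tangent j f) - tangent j (tangent i f)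
  = \sum_k pder (inr (dep_var k)) f
      * (tangent j (at_point (slope F i k)) - tangent i (at_point (slope F j k))).
Proof.
have Di := tangent_derivation i; have Dj := tangent_derivation j.
apply: (@vector_field_bracket _ _ (pder (inr (free_var i))) (pder (inr (free_var j)))
  (fun k => pder (inr (dep_var k))) (fun k => at_point (slope F i k))
  (fun k => at_point (slope F j k)) (tangent i) (tangent j)).
- by [].
- by [].
- exact: derD Di.
- exact: derD Dj.
- exact: derM Di.
- exact: derM Dj.
- by move=> x; exact: pder_comm.
- by move=> k x; exact: pder_comm.
- by move=> k x; exact: pder_comm.
- by move=> k l x; exact: pder_comm.
Qed.

(** The bracket is a combination of the dependent partial derivatives and kills the defining series.
    Their Jacobian in those variables is nonsingular, so all its coefficients are zero. *)
Lemma tangent_comm i j f : tangent i (tangent j f) = tangent j (tangent i f).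
Proof.
pose c k := tangent j (at_point (slope F i k)) - tangent i (at_point (slope F j k)).
have c0 k : c k = 0.
  apply: (ideal_linear_system (fps_prime_ideal _ K)
    (N := \matrix_(l, k) pder (inr (dep_var k)) (at_point (defining F l))))
    => [/(congr1 (coef0 (K := K)))|l].
    rewrite rmorph0 -det_map_mx; apply/eqP.
    have -> : map_mx (coef0 (K := K))
        (\matrix_(l, k) pder (inr (dep_var k)) (at_point (defining F l))) =
        \matrix_(l, k) coef0 (pder (inr (dep_var k)) (defining F l)).
      apply/matrixP => l k'; rewrite !mxE pder_at_point coef0_subst //.
      exact: at_point_null.
    exact: (defining_det_conj F).
  under eq_bigr do rewrite mxE; rewrite -tangent_bracket !tangent_rho.
  by rewrite !(der0 (tangent_derivation _)) subrr.
apply/subr0_eq; rewrite tangent_bracket big1 // => k _.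
by rewrite -/(c k) c0 mulr0.
Qed.

End AlongPoint.
End Frames.

(** * Segre varieties *)

Section SegreVarieties.
Variables (K : numFieldType) (m d : nat) (F : tangent_frame K m d).
Local Notation n := (m + d)%N.

Definition on_segre (L : finType) (x : 'I_n -> fps L K) :=
  (forall i, coef0 (x i) = 0) /\
  forall l, fps_subst (defining F l) (sumf x (fun=> 0)) = 0.

(** A separate notion, because the abstract field [K] carries no conjugation that would derive it
    from [on_segre]. *)
Definition on_conj_segre (L : finType) (x : 'I_n -> fps L K) :=
  (forall i, coef0 (x i) = 0) /\
  forall l, fps_subst (defining F l) (sumf (fun=> 0) x) = 0.

Section ConjugateSegre.
Variables (J : finType) (theta : 'I_n -> fps J K).
Hypothesis theta0 : forall i, coef0 (theta i) = 0.
Variable L : finType.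
Implicit Type x : 'I_n -> fps L K.
Local Notation kappa x f := (fps_subst f (sumf (fun _ : J => 0) x)).

(** This is [tangent_chain] for the zero ideal. Setting the parameters of [theta] to 0 gives
    [t = 0], so the defining series become [rho (0, x)], which is zero. *)
Lemma pder_conj_segre x b f : on_conj_segre x ->
  pder b (kappa x f)
  = \sum_j kappa x (tangent F theta j f) * pder b (x (free_var F j)).
Proof.
move=> [x0 xS].
have null0 (j : J) : coef0 (0 : fps L K) = 0 by rewrite rmorph0.
have nx0 := coef0_sumf null0 x0.
have P_coef0 (a : fps L K) : a = 0 -> coef0 a = 0 by move=> ->; exact: rmorph0.
have D_null (j : J) : pder b (0 : fps L K) = 0 by exact: (der0 (pder_derivation _ b)).
apply/subr0_eq; apply: (tangent_chain theta0 null0 x0 (pder_derivation K b)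
  (fps_prime_ideal L K) P_coef0 D_null) => l.
rewrite /at_point subst_comp; [|exact: at_point_null|exact: nx0].
suff -> : (fun v => fps_subst (sumf (fun i => embl (theta i))
    (fun i => fpsX (inr i)) v) (sumf (fun _ : J => 0) x)) = sumf (fun=> 0) x.
  by rewrite xS (der0 (pder_derivation _ b)).
apply/funext => -[i|i] /=; last by rewrite subst_fpsX.
rewrite (subst_embl null0 x0) subst_zero theta0; apply/funext => g.
by rewrite /fpsC; case: eqP.
Qed.

(** The derivatives of [kappa x f] are combinations of the [kappa x] of tangential derivatives of
    [f], which again lie in [Z]; constant terms being zero, the order of vanishing grows without
    bound. *)
Lemma tangent_closed_conj_segre x (Z : fps (J + 'I_n)%type K -> Prop) :
  on_conj_segre x ->
  (forall f, Z f -> coef0 f = 0) -> (forall j f, Z f -> Z (tangent F theta j f)) ->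
  forall f, Z f -> kappa x f = 0.
Proof.
move=> xS Z0 ZD f Zf; apply: vanishP => N; elim: N f Zf => // N IH f Zf.
have x0 : forall v, coef0 (sumf (fun _ : J => 0) x v) = 0.
  by apply: coef0_sumf xS.1 => j; exact: rmorph0.
apply: vanish_integral => [|b]; first by rewrite coef0_subst // Z0.
rewrite pder_conj_segre //; apply: vanish_sum => j _; rewrite mulrC.
by apply/vanishMl/IH/ZD.
Qed.

End ConjugateSegre.

(* The series vanishing along x are stable under the tangential fields, because x
   has generic rank m; hence they vanish along y. *)
Lemma conj_segre_transfer (L L' : finType) (x : 'I_n -> fps L K)
    (y : 'I_n -> fps L' K) (c : 'I_m -> L) (q : fps 'I_n K) :
  on_conj_segre x -> on_conj_segre y ->
  \det (\matrix_(j, a) pder (c j) (x (free_var F a))) != 0 ->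
  fps_subst q x = 0 -> fps_subst q y = 0.
Proof.
move=> xS yS detx qx.
(* Only [t = 0] matters on the conjugate Segre variety, so a constant base point suffices; its
   parameter set is arbitrary. *)
pose theta (i : 'I_n) : fps 'I_n K := 0.
have th0 i : coef0 (theta i) = 0 by exact: rmorph0.
have n0 (A : finType) (j : 'I_n) : coef0 (0 : fps A K) = 0 by exact: rmorph0.
rewrite -(subst_embr (n0 L') yS.1).
pose Z (f : fps ('I_n + 'I_n)%type K) := fps_subst f (sumf (fun=> 0) x) = 0.
have x0 := coef0_sumf (n0 L) xS.1.
apply: (tangent_closed_conj_segre th0 (Z := Z) yS).
- by move=> f Zf; rewrite -(coef0_subst x0) Zf rmorph0.
- move=> j f Zf.
  have H : forall j, fps_subst (tangent F theta j f) (sumf (fun=> 0) x) = 0.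
    apply: (ideal_linear_system (fps_prime_ideal L K)
        (N := \matrix_(j, a) pder (c j) (x (free_var F a)))) => [|b].
      exact/eqP.
    transitivity (pder (c b) (fps_subst f (sumf (fun=> 0) x))).
      by rewrite (pder_conj_segre th0 _ _ xS); apply: eq_bigr => a _; rewrite mxE mulrC.
    by rewrite Zf (der0 (pder_derivation _ _)).
  exact: H.
by rewrite /Z (subst_embr (n0 L) xS.1).
Qed.

(** The free coordinates form a chart of the Segre variety. A tangent vector [y] with no free part
    satisfies the linearized equations, which determine its dependent part to be zero; full rank of
    [x] then excludes [v]. *)
Lemma segre_jacobian (x : 'I_n -> fps 'I_m K) :
  on_segre x -> \rank (jac0 x) = m ->
  \det (\matrix_(b, a) coef0 (pder b (x (free_var F a)))) != 0.
Proof.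
move=> [x0 xS] rx; apply/det0P => -[v v0 vx].
pose y i := \sum_b v 0 b * coef0 (pder b (x i)).
have yfree a : y (free_var F a) = 0.
  have := congr1 (fun u : 'rV_m => u 0 a) vx; rewrite !mxE => <-.
  by apply: eq_bigr => b _; rewrite mxE.
have sx0 : forall v : tvars n, coef0 (sumf x (fun=> 0) v) = 0.
  by apply: coef0_sumf => // j; rewrite rmorph0.
have ysum l : \sum_i coef0 (pder (inl i) (defining F l)) * y i = 0.
  under eq_bigr do rewrite mulr_sumr.
  rewrite exchange_big /= big1 // => b _.
  have /(congr1 (pder b)) := xS l.
  rewrite (chain_rule (pder_derivation _ b)) // (der0 (pder_derivation _ b)).
  rewrite big_sumType /= [X in _ + X]big1 ?addr0 => [|i _]; last first.
    by rewrite (der0 (pder_derivation _ b)) mulr0.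
  move/(congr1 (coef0 (K := K))); rewrite rmorph0 rmorph_sum /= => xl.
  transitivity (v 0 b * \sum_i coef0 (pder (inl i) (defining F l)) * coef0 (pder b (x i))).
    by rewrite mulr_sumr; apply: eq_bigr => i _; rewrite mulrCA.
  suff -> : \sum_i coef0 (pder (inl i) (defining F l)) * coef0 (pder b (x i)) = 0.
    exact: mulr0.
  by rewrite -[RHS]xl; apply: eq_bigr => i _; rewrite rmorphM /= coef0_subst.
have ydep k : y (dep_var F k) = 0.
  move: k; apply: (ideal_linear_system (numDomain_prime_ideal K)
    (N := \matrix_(j, k) coef0 (pder (inl (dep_var F k)) (defining F j)))) => [|l].
    by apply/eqP; exact: (defining_det F).
  have := ysum l; rewrite (sum_frame F) big1 ?add0r => [yl|a _]; last first.
    by rewrite yfree mulr0.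
  by rewrite -[RHS]yl; apply: eq_bigr => k _; rewrite mxE.
have yi i : y i = 0.
  rewrite -(permKV (coord F) i); case: (splitP ((coord F)^-1%g i)) => j ij.
    rewrite (_ : (coord F)^-1%g i = lshift d j); [exact: yfree|exact: val_inj].
  rewrite (_ : (coord F)^-1%g i = rshift m j); [exact: ydep|exact: val_inj].
have fx : row_free (jac0 x)^T by rewrite /row_free mxrank_tr rx.
case/eqP: v0; apply: (row_free_inj fx); rewrite mul0mx; apply/rowP => i.
by rewrite !mxE -[RHS](yi i); apply: eq_bigr => b _; rewrite !mxE.
Qed.

Lemma segre_jacobian_neq0 (x : 'I_n -> fps 'I_m K) :
  on_segre x -> \rank (jac0 x) = m ->
  \det (\matrix_(b, a) pder b (x (free_var F a))) != 0.
Proof.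
move=> xS rx; apply: contraNneq (segre_jacobian xS rx) => det0.
apply/eqP; rewrite -[RHS](rmorph0 (coef0 (I := 'I_m) (K := K))) -det0 -det_map_mx.
by congr (\det _); apply/matrixP => b a; rewrite !mxE.
Qed.

(** By the chain rule the matrix is the chosen minor of [G] times the free Jacobian of [x] composed
    with [G]; the latter keeps its nonzero constant determinant at 0. *)
Lemma segre_reparametrization_rank k (x : 'I_n -> fps 'I_m K)
    (G : 'I_m -> fps 'I_k K) (c : 'I_m -> 'I_k) :
  on_segre x -> \rank (jac0 x) = m -> (forall e, coef0 (G e) = 0) ->
  \det (\matrix_(i, j) pder (c j) (G i)) != 0 ->
  \det (\matrix_(j, a) pder (c j) (fps_subst (x (free_var F a)) G)) != 0.
Proof.
move=> xS rx G0 detG; pose N := \matrix_(b, a) pder b (x (free_var F a)).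
have -> : \matrix_(j, a) pder (c j) (fps_subst (x (free_var F a)) G)
    = (\matrix_(i, j) pder (c j) (G i))^T *m \matrix_(e, a) fps_subst (N e a) G.
  apply/matrixP => j a; rewrite [LHS]mxE [RHS]mxE.
  rewrite (chain_rule (pder_derivation _ _) _ G0); apply: eq_bigr => e _.
  by rewrite !mxE mulrC.
rewrite det_mulmx det_tr -(subst_det G0) mulf_eq0 negb_or detG /=.
apply: contraNneq (segre_jacobian xS rx) => det0.
have := congr1 (coef0 (K := K)) det0; rewrite (coef0_subst G0) rmorph0 -det_map_mx => <-.
by apply/eqP; congr (\det _); apply/matrixP => b a; rewrite !mxE.
Qed.

End SegreVarieties.

Lemma jac0_comp (K : comNzRingType) p q r (f : 'I_p -> fps 'I_q K) (u : 'I_q -> fps 'I_r K) :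
  (forall i, coef0 (u i) = 0) ->
  jac0 (fun k => fps_subst (f k) u) = jac0 f *m jac0 u.
Proof.
move=> u0; apply/matrixP => i b; rewrite [LHS]mxE [RHS]mxE.
rewrite (chain_rule (pder_derivation _ _) _ u0) rmorph_sum; apply: eq_bigr => k _.
by rewrite rmorphM /= (coef0_subst u0) !mxE.
Qed.

(** * Transfer of nondegeneracy *)

Section LiftedFields.
Variables (K : numFieldType) (m d N : nat) (F : tangent_frame K m d).
Local Notation n := (m + d)%N.
Local Notation vars3 := (tvars n + 'I_N)%type.

(** Written so that for a frame it agrees with [vf] by conversion. Its slopes do not involve [t'],
    whence it commutes with the derivatives in [t']. *)
Definition lifted_field (j : 'I_m) (f : fps vars3 K) : fps vars3 K :=
  pder (inl (inr (free_var F j))) f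
  - \sum_k embl (slope F j k) * pder (inl (inr (dep_var F k))) f.

Lemma pder_lifted_field k j f :
  pder (inr k) (lifted_field j f) = lifted_field j (pder (inr k) f).
Proof.
have Dk := pder_derivation K (inr k : vars3).
rewrite /lifted_field (derB Dk) (der_sum Dk) pder_comm; congr (_ - _).
by apply: eq_bigr => i _; rewrite (derM Dk) pder_inr_embl mul0r add0r pder_comm.
Qed.

Lemma pder_lifted_jet k s g f :
  pder (inr k) (jet lifted_field s g f) = jet lifted_field s g (pder (inr k) f).
Proof.
elim: s => [//|j s IH] /=; rewrite -IH.
by elim: (g j) => [//|q IHq]; rewrite !iterS pder_lifted_field IHq.
Qed.

Variables (J : finType) (theta : 'I_n -> fps J K) (chi : 'I_N -> fps J K).
Hypotheses (theta0 : forall i, coef0 (theta i) = 0) (chi0 : forall k, coef0 (chi k) = 0).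

(* f(theta(w), tau, chi(w)) *)
Definition place (f : fps vars3 K) : fps (J + 'I_n)%type K :=
  fps_subst f (sumf (sumf (fun i => embl (theta i)) (fun i => fpsX (inr i)))
                    (fun k => embl (chi k))).

Lemma embl_chi0 k : coef0 (embl (chi k) : fps (J + 'I_n)%type K) = 0.
Proof. by rewrite coef0_embl. Qed.

Lemma place_null v :
  coef0 (sumf (sumf (fun i => embl (theta i)) (fun i => fpsX (inr i)))
              (fun k => embl (chi k) : fps (J + 'I_n)%type K) v) = 0.
Proof. by apply: coef0_sumf; [exact: at_point_null|exact: embl_chi0]. Qed.

Lemma pder_place i f : pder (inr i) (place f) = place (pder (inl (inr i)) f).
Proof.
rewrite (chain_rule (pder_derivation _ _) _ place_null) big_sumType /=.
rewrite [X in _ + X]big1 => [|k _]; last by rewrite pder_inr_embl mulr0.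
rewrite big_sumType /= big1 => [|k _]; last by rewrite pder_inr_embl mulr0.
rewrite addr0 add0r.
exact: (sum_pder_fpsX (f := inr) (fun k => place (pder (inl (inr k)) f)) i inr_inj).
Qed.

Lemma place_lifted_field j f :
  place (lifted_field j f) = tangent F theta j (place f).
Proof.
rewrite /tangent pder_place {1}/place (substB place_null) (subst_sum place_null).
congr (_ - _); apply: eq_bigr => k _; rewrite pder_place (substM place_null).
congr (_ * _); rewrite subst_embl //; [exact: at_point_null|exact: embl_chi0].
Qed.

Lemma place_jet s g f :
  place (jet lifted_field s g f) = jet (tangent F theta) s g (place f).
Proof.
elim: s => [//|j s IH] /=; rewrite -IH.
by elim: (g j) => [//|q IHq]; rewrite !iterS place_lifted_field IHq.
Qed.

End LiftedFields.

Section ConjugateDefiningSeries.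
Variables (K : numFieldType) (m d m' d' : nat).
Variables (F : tangent_frame K m d) (F' : tangent_frame K m' d').
Local Notation n := (m + d)%N.
Local Notation n' := (m' + d')%N.
Variable hb : 'I_n' -> fps 'I_n K.
Hypothesis hb0 : forall i, coef0 (hb i) = 0.

(* rho'_l(t', hb(tau)) *)
Definition defining_conj (l : 'I_d') : fps (tvars n + 'I_n')%type K :=
  fps_subst (defining F' l) (sumf (fun k => fpsX (inr k))
    (fun k => fps_subst (hb k) (fun i => fpsX (inl (inr i))))).

Lemma defining_conj_null v :
  coef0 (sumf (fun k => fpsX (inr k))
    (fun k => fps_subst (hb k) (fun i => fpsX (inl (inr i)))) v
      : fps (tvars n + 'I_n')%type K) = 0.
Proof.
case: v => i /=; first exact: coef0_fpsX.
by rewrite coef0_subst // => j; exact: coef0_fpsX.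
Qed.

Lemma pder_defining_conj k l :
  pder (inr k) (defining_conj l) = fps_subst (pder (inl k) (defining F' l))
    (sumf (fun k => fpsX (inr k))
      (fun k => fps_subst (hb k) (fun i => fpsX (inl (inr i))))).
Proof.
have Dk := pder_derivation K (inr k : (tvars n + 'I_n')%type).
rewrite (chain_rule Dk _ defining_conj_null) big_sumType /=.
rewrite [X in _ + X]big1 => [|j _]; last first.
  rewrite (chain_rule Dk) => [|i]; last exact: coef0_fpsX.
  by rewrite big1 ?mulr0 // => i _; rewrite pder_fpsX mulr0.
rewrite addr0.
exact: (sum_pder_fpsX (f := inr) (fun k => fps_subst (pder (inl k) (defining F' l)) _) k inr_inj).
Qed.

Lemma place_defining_conj (J : finType) (theta : 'I_n -> fps J K) (chi : 'I_n' -> fps J K) k l :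
  (forall i, coef0 (theta i) = 0) -> (forall k, coef0 (chi k) = 0) ->
  place theta chi (pder (inr k) (defining_conj l)) =
  fps_subst (pder (inl k) (defining F' l))
    (sumf (fun k => embl (chi k)) (fun k => embr (hb k))).
Proof.
move=> theta0 chi0; have pl0 := place_null theta0 chi0.
rewrite pder_defining_conj /place (subst_comp _ defining_conj_null pl0).
congr fps_subst; apply/funext => -[i|i] /=; first by rewrite (subst_fpsX pl0).
rewrite subst_comp; [|by move=> j; exact: coef0_fpsX|exact: pl0].
by congr fps_subst; apply/funext => j; rewrite (subst_fpsX pl0).
Qed.

End ConjugateDefiningSeries.

Section Transfer.
Variables (K : numFieldType) (m d m' d' : nat).
Variables (F : tangent_frame K m d) (F' : tangent_frame K m' d').
Local Notation n := (m + d)%N.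
Local Notation n' := (m' + d')%N.
Variables (x xb : 'I_n -> fps 'I_m K).
Hypotheses (xS : on_segre F x) (xbS : on_conj_segre F xb).
Variables (h hb : 'I_n' -> fps 'I_n K).
Hypotheses (h0 : forall i, coef0 (h i) = 0) (hb0 : forall i, coef0 (hb i) = 0).
Variable mu : 'I_d' -> 'I_d -> fps (tvars n) K.
Hypothesis h_maps : forall l,
  fps_subst (defining F' l) (sumf (fun k => embl (h k)) (fun k => embr (hb k)))
  = \sum_j mu l j * defining F j.
Let y k := fps_subst (h k) x.
Let yb k := fps_subst (hb k) xb.
Variable c : 'I_m' -> 'I_m.
Hypothesis yb_rank : \det (\matrix_(j, a) pder (c j) (yb (free_var F' a))) != 0.

Let x0 := xS.1.
Let y0 k : coef0 (y k) = 0.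
Proof. by rewrite coef0_subst. Qed.
Let z0 (I J : finType) (i : I) : coef0 (0 : fps J K) = 0.
Proof. exact: rmorph0. Qed.
Let X0 (I : finType) (i : I) : coef0 (fpsX i : fps I K) = 0.
Proof. exact: coef0_fpsX. Qed.

Local Notation A := (fps ('I_m + 'I_n)%type K).
Local Notation A' := (fps ('I_m + 'I_n')%type K).

Definition at_origin (J I : finType) (f : fps (J + I)%type K) : fps J K :=
  fps_subst f (sumf (fun j => fpsX j) (fun=> 0)).

Let at_origin_null (J I : finType) (v : J + I) :
  coef0 (sumf (fun j => fpsX j) (fun=> 0) v : fps J K) = 0.
Proof. by apply: coef0_sumf. Qed.

(** The substitution [tau' = hb (tau)], with [w] kept: through it the ideal P of [A] tests series of
    [A']. *)
Let H (f : A') : A :=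
  fps_subst f (sumf (fun j => fpsX (inl j)) (fun i => embr (hb i))).

Let H_null (v : 'I_m + 'I_n') :
  coef0 (sumf (fun j => fpsX (inl j)) (fun i => embr (hb i)) v : A) = 0.
Proof.
case: v => i /=; first exact: X0.
by rewrite coef0_embr.
Qed.

Let D := tangent F x.
Let D' := tangent F' y.

(* P is the ideal of the family of Segre varieties rho(x(w), tau) = 0, described as
   the set of series vanishing to infinite order at tau = 0 along D. *)
Let P : A -> Prop := jet_ideal D (fun f => at_origin f = 0) (enum 'I_m).

Let P_prime : prime_ideal P.
Proof.
apply: jet_prime_ideal.
- by move=> j; exact: (derD (tangent_derivation F x j)).
- by move=> j; exact: (derM (tangent_derivation F x j)).
- exact: enum_uniq.
exact: (preim_prime_ideal (subst_rm (@at_origin_null 'I_m 'I_n)) (fps_prime_ideal _ K)).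
Qed.

Let P_der j f : P f -> P (D j f).
Proof. by apply: jet_ideal_der => i k a; exact: (tangent_comm F x0). Qed.

Let P_at_origin f : P f -> at_origin f = 0.
Proof. by move=> Pf; have := Pf (mexp0 _); rewrite jet_mexp0. Qed.

Let P_coef0 f : P f -> coef0 f = 0.
Proof.
by move=> /P_at_origin f0; rewrite -(coef0_subst (@at_origin_null _ _)) [fps_subst _ _]f0 rmorph0.
Qed.

(** The series is zero at [tau = 0] by [xS] and is killed by the fields, so each of its jets is the
    series itself or 0. *)
Let P_eqn l : P (at_point x (defining F l)).
Proof.
have r0 : at_origin (at_point x (defining F l)) = 0.
  rewrite /at_origin /at_point (subst_comp _ (at_point_null x0) (@at_origin_null _ _)).
  rewrite -[RHS](xS.2 l); congr fps_subst; apply/funext => -[i|i] /=.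
    by rewrite (subst_embl (@X0 _) (@z0 _ _)) subst_id.
  by rewrite (subst_fpsX (@at_origin_null _ _)).
move=> g; have [-> //|->] : jet D (enum 'I_m) g (at_point x (defining F l)) = at_point x (defining F l)
    \/ jet D (enum 'I_m) g (at_point x (defining F l)) = 0.
  elim: (enum 'I_m) => [|j s IH] /=; first by left.
  elim: (g j) => [//|q [IHq|IHq]]; rewrite iterS IHq; right.
    exact: tangent_rho.
  exact: (der0 (tangent_derivation F x j)).
exact: (subst0 (@at_origin_null _ _)).
Qed.

Let H_eqn l : P (H (at_point y (defining F' l))).
Proof.
have -> : H (at_point y (defining F' l)) = at_point x (\sum_j mu l j * defining F j).
  have h3 (v : tvars n') :
      coef0 (sumf (fun k => embl (h k)) (fun k => embr (hb k)) v : fps (tvars n) K) = 0.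
    case: v => i /=; first by rewrite coef0_embl; exact: h0.
    by rewrite coef0_embr; exact: hb0.
  rewrite -h_maps /H /at_point (subst_comp _ (at_point_null y0) H_null).
  rewrite (subst_comp _ h3 (at_point_null x0)).
  congr fps_subst; apply/funext => -[i|i] /=.
    rewrite (subst_embl (x := fun j => fpsX (inl j)) (y := fun i => embr (hb i))).
    - rewrite (subst_embl (x := fun i => embl (x i))).
      + rewrite /embl /y subst_comp //.
      + by move=> j; rewrite coef0_embl.
      + by move=> j; exact: X0.
    - by move=> j; exact: X0.
    - by move=> j; rewrite coef0_embr.
  rewrite (subst_fpsX H_null) /=.
  rewrite (subst_embr (x := fun i => embl (x i)) (y := fun i => fpsX (inr i))) //.
  by move=> j; rewrite coef0_embl.
rewrite /at_point (subst_sum (at_point_null x0)); apply: (ideal_sum P_prime) => j _.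
rewrite (substM (at_point_null x0)); apply: (idealM P_prime); exact: P_eqn.
Qed.

Local Notation kappa f := (fps_subst f (sumf (fun _ : 'I_m => 0) xb)).

Let kappa_null (v : 'I_m + 'I_n) : coef0 (sumf (fun _ : 'I_m => 0) xb v : fps 'I_m K) = 0.
Proof. by apply: coef0_sumf => //; exact: xbS.1. Qed.

Let P_kappa f : P f -> kappa f = 0.
Proof. exact: (tangent_closed_conj_segre x0 xbS P_coef0 P_der). Qed.

(** Along the conjugate Segre variety, the Jacobian of [yb] factors as [B *m Q], with [Q] the
    restriction of the matrix of all the [D j] applied to [hb]. Hence [m'] of the fields give a
    minor that is nonzero there, and elements of P vanish there. *)
Let hb_minor : exists c' : 'I_m' -> 'I_m,
  ~ P (\det (\matrix_(j, a) D (c' j) (embr (hb (free_var F' a))))).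
Proof.
pose Q := \matrix_(j, a) kappa (D j (embr (hb (free_var F' a)))).
pose B := \matrix_(j, b) pder (c j) (xb (free_var F b)).
have BQ : B *m Q = \matrix_(j, a) pder (c j) (yb (free_var F' a)).
  apply/matrixP => j a; rewrite !mxE.
  rewrite -[yb _](subst_embr (@z0 'I_m 'I_m) xbS.1).
  rewrite (pder_conj_segre x0 _ _ xbS); apply: eq_bigr => b _.
  by rewrite !mxE mulrC.
have [c' detc'] : exists c' : 'I_m' -> 'I_m, \det (rowsub c' Q) != 0.
  by apply: (@minor_of_product _ _ _ B); rewrite BQ.
exists c' => /P_kappa; rewrite (subst_det kappa_null) => det0.
case/eqP: detc'; rewrite -det0; congr (\det _).
by apply/matrixP => j a; rewrite !mxE.
Qed.

(** Modulo P, [D j (H f)] is the combination of the [H (D' a f)] with coefficients [D j (hb a)], by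
    [tangent_chain] for the target frame; the minor of [hb_minor] solves for them. *)
Let H_tangent a f : P (H f) -> P (H (D' a f)).
Proof.
move=> Pf; have [c' Pc'] := hb_minor.
move: a; apply: (ideal_linear_system P_prime Pc') => j.
have D_inl (i : 'I_m) : D (c' j) (fpsX (inl i)) = 0 by exact: tangent_inl.
have inl0 (i : 'I_m) : coef0 (fpsX (inl i) : A) = 0 by exact: X0.
have hb0' i : coef0 (embr (hb i) : A) = 0 by rewrite coef0_embr.
have PD l : P (D (c' j) (H (at_point y (defining F' l)))) by apply/P_der/H_eqn.
have := tangent_chain y0 inl0 hb0' (tangent_derivation F x (c' j)) P_prime P_coef0
  D_inl PD f.
move/(idealB P_prime (P_der (c' j) Pf)); rewrite opprB addrCA subrr addr0.
congr P; apply: eq_bigr => a _.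
by rewrite mxE mulrC.
Qed.

Lemma jet_transfer (v : 'I_n' -> fps 'I_m K) :
  (forall g l, \sum_k at_origin (jet D (enum 'I_m) g
     (fps_subst (pder (inl k) (defining F' l))
        (sumf (fun k => embl (y k)) (fun k => embr (hb k))))) * v k = 0) ->
  forall g l, \sum_k at_origin (jet D' (enum 'I_m') g
     (at_point y (pder (inl k) (defining F' l)))) * v k = 0.
Proof.
move=> Dv g l.
pose q k := at_point y (pder (inl k) (defining F' l)).
(* The coefficients [v k] depend on [w] alone, so both families of fields treat them as constants
   and a relation between vectors becomes a statement about the single series [f]. *)
pose f := \sum_k q k * embl (v k).
have jetE (m1 d1 : nat) (F1 : tangent_frame K m1 d1) (th : 'I_(m1 + d1) -> fps 'I_m K) s g1
    (w : 'I_n' -> fps ('I_m + 'I_(m1 + d1))%type K) :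
    at_origin (jet (tangent F1 th) s g1 (\sum_k w k * embl (v k)))
    = \sum_k at_origin (jet (tangent F1 th) s g1 (w k)) * v k.
  have -> : jet (tangent F1 th) s g1 (\sum_k w k * embl (v k))
      = \sum_k jet (tangent F1 th) s g1 (w k) * embl (v k).
    elim: s => [//|j s IH] /=; rewrite IH.
    elim: (g1 j) => [//|e IHe]; rewrite !iterS IHe.
    rewrite (der_sum (tangent_derivation F1 th j)); apply: eq_bigr => k _.
    by rewrite (derM (tangent_derivation F1 th j)) tangent_embl mulr0 addr0.
  rewrite /at_origin (subst_sum (@at_origin_null _ _)); apply: eq_bigr => k _.
  rewrite (substM (@at_origin_null _ _)); congr (_ * _).
  by rewrite (subst_embl (@X0 _) (@z0 _ _)) subst_id.
have PHf : P (H f).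
  have -> : H f = \sum_k fps_subst (pder (inl k) (defining F' l))
      (sumf (fun k => embl (y k)) (fun k => embr (hb k))) * embl (v k).
    rewrite /H /f (subst_sum H_null); apply: eq_bigr => k _.
    have inl0 (i : 'I_m) : coef0 (fpsX (inl i) : A) = 0 by exact: X0.
    have hb0' i : coef0 (embr (hb i) : A) = 0 by rewrite coef0_embr.
    rewrite (substM H_null) (subst_embl inl0 hb0'); congr (_ * _).
    rewrite /q /at_point (subst_comp _ (at_point_null y0) H_null).
    congr fps_subst; apply/funext => -[i|i] /=; first by rewrite (subst_embl inl0 hb0').
    by rewrite (subst_fpsX H_null).
  by move=> g1; rewrite jetE; exact: Dv.
have PHjet s : P (H (jet D' s g f)).
  elim: s => [//|a s IH] /=; elim: (g a) => [//|e IHe].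
  by rewrite iterS; exact: H_tangent.
(* Since [hb] vanishes at 0, applying [H] does not change the restriction to [tau = 0]. *)
rewrite -(jetE _ _ F' y) -/f -(P_at_origin (PHjet (enum 'I_m'))).
rewrite /at_origin /H (subst_comp _ H_null (@at_origin_null _ _)).
congr fps_subst; apply/funext => -[i|i] /=; first by rewrite (subst_fpsX (@at_origin_null _ _)).
rewrite (subst_embr (@X0 _) (@z0 _ _)) subst_zero hb0; apply/funext => e.
by rewrite /fpsC; case: eqP.
Qed.

End Transfer.

Section Diagonal.
Variables (K : numFieldType) (m d : nat) (F : tangent_frame K m d).
Local Notation n := (m + d)%N.

(* f(t, 0, t) *)
Definition diagonal (f : fps (tvars n + 'I_n)%type K) : fps 'I_n K :=
  fps_subst f (sumf (sumf (fun i => fpsX i) (fun=> 0)) (fun i => fpsX i)).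

Lemma at_origin_place_diagonal (J : finType) (x : 'I_n -> fps J K) f :
  (forall i, coef0 (x i) = 0) ->
  at_origin (place x x f) = fps_subst (diagonal f) x.
Proof.
move=> x0.
have z0 (I : finType) (i : 'I_n) : coef0 (0 : fps I K) = 0 by exact: rmorph0.
have X0 (I : finType) (i : I) : coef0 (fpsX i : fps I K) = 0 by exact: coef0_fpsX.
have o0 := coef0_sumf (X0 J) (z0 J).
have d0 := coef0_sumf (coef0_sumf (X0 'I_n) (z0 'I_n)) (X0 'I_n).
rewrite /at_origin /place /diagonal (subst_comp _ (place_null x0 x0) o0).
rewrite (subst_comp _ d0 x0); congr fps_subst; apply/funext => -[[i|i]|i] /=.
- by rewrite (subst_embl (X0 J) (z0 J)) subst_id (subst_fpsX x0).
- by rewrite (subst_fpsX o0) (subst0 x0).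
- by rewrite (subst_embl (X0 J) (z0 J)) subst_id (subst_fpsX x0).
Qed.

End Diagonal.

Section NondegeneracyTransfer.
Variables (K : numFieldType) (m d m' d' : nat).
Variables (F : tangent_frame K m d) (F' : tangent_frame K m' d').
Local Notation n := (m + d)%N.
Local Notation n' := (m' + d')%N.

(** [S_nondegenerate] with [conj h] replaced by free data; the exponent and the index of the
    equation form one pair, the index type of [nonsingular_selection]. *)
Definition nondegenerate (J : finType) (x : 'I_n -> fps J K) (y : 'I_n' -> fps J K)
    (hb : 'I_n' -> fps 'I_n K) :=
  exists s : 'I_n' -> mexp 'I_m * 'I_d',
    \det (\matrix_(j, k) at_origin (place x y
      (pder (inr k) (jet (lifted_field F) (enum 'I_m) (s j).1
        (defining_conj F' hb (s j).2))))) != 0.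

Lemma nondegenerate_entry (J : finType) (x : 'I_n -> fps J K) (y : 'I_n' -> fps J K)
    (hb : 'I_n' -> fps 'I_n K) g l k :
  (forall i, coef0 (x i) = 0) -> (forall k, coef0 (y k) = 0) ->
  (forall k, coef0 (hb k) = 0) ->
  at_origin (place x y
    (pder (inr k) (jet (lifted_field F) (enum 'I_m) g (defining_conj F' hb l))))
  = at_origin (jet (tangent F x) (enum 'I_m) g
     (fps_subst (pder (inl k) (defining F' l))
        (sumf (fun k => embl (y k)) (fun k => embr (hb k))))).
Proof.
by move=> x0 y0 hb0; rewrite pder_lifted_jet place_jet // place_defining_conj.
Qed.

End NondegeneracyTransfer.

Lemma nondegenerate_transfer (K : numFieldType) (m d m' d' : nat)
    (F : tangent_frame K m d) (F' : tangent_frame K m' d')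
    (x xb : 'I_(m + d) -> fps 'I_m K) (x' : 'I_(m' + d') -> fps 'I_m' K)
    (h hb : 'I_(m' + d') -> fps 'I_(m + d) K)
    (mu : 'I_d' -> 'I_d -> fps (tvars (m + d)) K) (c : 'I_m' -> 'I_m) :
  on_segre F x -> on_conj_segre F xb -> (forall i, coef0 (x' i) = 0) ->
  (forall i, coef0 (h i) = 0) -> (forall i, coef0 (hb i) = 0) ->
  (forall l, fps_subst (defining F' l) (sumf (fun k => embl (h k)) (fun k => embr (hb k)))
     = \sum_j mu l j * defining F j) ->
  \det (\matrix_(j, a) pder (c j) (fps_subst (hb (free_var F' a)) xb)) != 0 ->
  (forall q, fps_subst q (fun k => fps_subst (h k) x) = 0 -> fps_subst q x' = 0) ->
  nondegenerate F' F' x' x' (fun k => fpsX k) ->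
  nondegenerate F F' x (fun k => fps_subst (h k) x) hb.
Proof.
move=> xS xbS x'0 h0 hb0 h_maps rank_yb ker_y [s'].
set y := fun k => fps_subst (h k) x.
have y0 k : coef0 (y k) = 0 by rewrite coef0_subst; [exact: h0|exact: xS.1].
have X0 (k : 'I_(m' + d')) : coef0 (fpsX k : fps _ K) = 0 by exact: coef0_fpsX.
(* For the identity map the matrix comes from series in [t'] restricted to [x']. Its determinant can
   thus be moved from [x'] to [y], using the hypothesis on kernels. *)
pose q j k := diagonal (pder (inr k) (jet (lifted_field F') (enum 'I_m') (s' j).1
        (defining_conj F' (fun k => fpsX k) (s' j).2))).
have -> : (\matrix_(j, k) at_origin (place x' x' (pder (inr k)
        (jet (lifted_field F') (enum 'I_m') (s' j).1
        (defining_conj F' (fun k => fpsX k) (s' j).2)))))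
    = \matrix_(j, k) fps_subst ((\matrix_(j, k) q j k) j k) x'.
  by apply/matrixP => j k; rewrite [LHS]mxE [RHS]mxE mxE at_origin_place_diagonal.
rewrite -(subst_det x'0) => det_q.
have {det_q} det_qy : \det (\matrix_(j, k) fps_subst ((\matrix_(j, k) q j k) j k) y) != 0.
  by rewrite -(subst_det y0); apply: contraNneq det_q => /ker_y/eqP.
suff inj v : (forall t : mexp 'I_m * 'I_d', \sum_k at_origin (place x y
      (pder (inr k) (jet (lifted_field F) (enum 'I_m) t.1
        (defining_conj F' hb t.2)))) * v k = 0) -> forall k, v k = 0.
  exact: nonsingular_selection inj.
move=> Vv; move/eqP: det_qy => det_qy.
apply: (ideal_linear_system (fps_prime_ideal 'I_m K) det_qy) => j.
have Wv : forall g l, \sum_k at_origin (jet (tangent F' y) (enum 'I_m') g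
     (at_point y (pder (inl k) (defining F' l)))) * v k = 0.
  apply: (jet_transfer xS xbS h0 hb0 h_maps rank_yb) => g l.
  rewrite -[RHS](Vv (g, l)); apply: eq_bigr => k _.
  by rewrite (nondegenerate_entry F F' g l k xS.1 y0 hb0).
rewrite -[RHS](Wv (s' j).1 (s' j).2); apply: eq_bigr => k _; congr (_ * _).
rewrite !mxE -(at_origin_place_diagonal _ y0).
rewrite (nondegenerate_entry F' F' _ _ _ y0 y0 X0) /at_point.
congr (at_origin (jet _ _ _ (fps_subst _ _))); apply/funext => -[i|i] //=.
by rewrite /embr subst_fpsX // => e; exact: coef0_fpsX.
Qed.

(** * Frames of submanifolds *)

Section FrameFields.
Variable R : realType.
Local Notation K := R[i].
Variables (m d : nat) (M : set 'rV[K]_(m + d)) (p : 'rV[K]_(m + d)).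
Variable F : frame M p.
Local Notation n := (m + d)%N.

Lemma rho_real l : real_valued (rho F l).
Proof. by case: (rho_def F) => _ /(_ l). Qed.

Lemma numb_det_conj : \det (\matrix_(l < d, k < d)
  coef0 (pder (inr (numb F (rshift m k))) (rho F l))) != 0.
Proof.
have -> : \matrix_(l, k) coef0 (pder (inr (numb F (rshift m k))) (rho F l))
    = map_mx Num.conj (\matrix_(j < d, k < d)
        coef0 (pder (inl (numb F (rshift m k))) (rho F j))).
  apply/matrixP => l k; rewrite [LHS]mxE [RHS]mxE mxE.
  exact: (coef0_pder_real _ (rho_real l)).
rewrite det_map_mx fmorph_eq0; exact: (numb_det F).
Qed.

Definition frame_fields : tangent_frame K m d :=
  TangentFrame (numb_det F) numb_det_conj (vfc_tangent F).

Lemma on_segre_conj (L : finType) (x : 'I_n -> fps L K) :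
  on_segre frame_fields x -> on_conj_segre frame_fields (fun i => fps_conj (x i)).
Proof.
move=> [x0 xS]; split=> [i|l]; first by rewrite coef0_conj x0 rmorph0.
have z0 (i : 'I_n) : coef0 (0 : fps L K) = 0 by exact: rmorph0.
have E := conj_subst_real (rho_real l) (coef0_sumf x0 z0).
refine (etrans _ (etrans (esym E) _)); last by rewrite [fps_subst _ _](xS l) rmorph0.
congr fps_subst; apply/funext => -[i|i] //=.
by rewrite rmorph0.
Qed.

Lemma phi_on_segre : on_segre frame_fields (phi F).
Proof.
have phi0 := phi0 F; split=> [|l]; first exact: phi0.
have n0 (v : tvars n) : coef0 (match v with inl k => fpsX k | inr _ => 0 end : fps 'I_n K) = 0.
  by case: v => i; [exact: coef0_fpsX|exact: rmorph0].
rewrite -[RHS](phi_segre F l) /at_tau0 (subst_comp _ n0 phi0).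
congr fps_subst; apply/funext => -[i|i] /=; last by rewrite (subst0 phi0).
by rewrite (subst_fpsX phi0).
Qed.

Lemma along_segreE m' d' (h : 'I_(m' + d') -> fps 'I_n K) f :
  (forall k, coef0 (h k) = 0) ->
  along_segre F h f = at_origin (place (phi F) (fun k => fps_subst (h k) (phi F)) f).
Proof.
move=> h0; have phi0 := phi0 F.
have y0 k : coef0 (fps_subst (h k) (phi F)) = 0 by rewrite coef0_subst.
have z0 (i : 'I_n) : coef0 (0 : fps 'I_m K) = 0 by exact: rmorph0.
have X0 (i : 'I_m) : coef0 (fpsX i : fps 'I_m K) = 0 by exact: coef0_fpsX.
have o0 := coef0_sumf X0 z0.
rewrite /at_origin /place (subst_comp _ (place_null phi0 y0) o0).
congr fps_subst; apply/funext => -[[i|i]|i] /=.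
- by rewrite (subst_embl X0 z0) subst_id.
- by rewrite (subst_fpsX o0).
- by rewrite (subst_embl X0 z0) subst_id.
Qed.

End FrameFields.

Section Maps.
Variable R : realType.
Local Notation K := R[i].
Variables (m d m' d' : nat).
Variables (M : set 'rV[K]_(m + d)) (p : 'rV[K]_(m + d)) (F : frame M p).
Variables (M' : set 'rV[K]_(m' + d')) (p' : 'rV[K]_(m' + d')) (F' : frame M' p').
Variable h : 'I_(m' + d') -> fps 'I_(m + d) K.

Lemma S_nondegenerateE : (forall k, coef0 (h k) = 0) ->
  S_nondegenerate F F' h <->
  nondegenerate (frame_fields F) (frame_fields F') (phi F)
    (fun k => fps_subst (h k) (phi F)) (fun k => fps_conj (h k)).
Proof.
move=> h0.
have E (g : 'I_(m' + d') -> mexp 'I_m) (l : 'I_(m' + d') -> 'I_d') :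
    \matrix_(j, k) along_segre F h (pder (inr k) (jet_fun F F' h (g j) (l j)))
    = \matrix_(j, k) at_origin (place (phi F) (fun k => fps_subst (h k) (phi F))
      (pder (inr k) (jet (lifted_field (frame_fields F)) (enum 'I_m) (g j)
        (defining_conj (frame_fields F') (fun k => fps_conj (h k)) (l j))))).
  by apply/matrixP => j k; rewrite [LHS]mxE [RHS]mxE (along_segreE _ _ h0).
split=> [[g [l gl]]|[s gl]].
  by exists (fun j => (g j, l j)); rewrite -(E g l).
exists (fun j => (s j).1), (fun j => (s j).2).
by rewrite (E (fun j => (s j).1) (fun j => (s j).2)).
Qed.

Hypothesis hF : formal_map F F' h.

(** Put [tau = 0] in the mapping identity: [conj h] has no constant term, and the defining series of
    the source vanish along [phi]. *)
Lemma image_on_segre :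
  on_segre (frame_fields F') (fun k => fps_subst (h k) (phi F)).
Proof.
have [h0 [mu hmu]] := hF; have phi0 := phi0 F.
have y0 k : coef0 (fps_subst (h k) (phi F)) = 0 by rewrite coef0_subst.
split=> [k|l]; first exact: y0.
have z0 (i : 'I_(m + d)) : coef0 (0 : fps 'I_m K) = 0 by exact: rmorph0.
have pz0 := coef0_sumf phi0 z0.
have hc0 v : coef0 (sumf (fun k => embl (h k)) (fun k => embr (fps_conj (h k))) v
    : fps (tvars (m + d)) K) = 0.
  case: v => k /=; first by rewrite coef0_embl.
  by rewrite coef0_embr coef0_conj h0 rmorph0.
have := congr1 (fun a => fps_subst a (sumf (phi F) (fun=> 0))) (hmu l).
rewrite (subst_sum pz0) big1 => [|j _]; last first.
  by rewrite (substM pz0) [fps_subst (rho F j) _]((phi_on_segre F).2 j) mulr0.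
move=> E; rewrite -[RHS]E /pullback [RHS](subst_comp _ hc0 pz0).
congr fps_subst; apply/funext => -[k|k] /=; first by rewrite (subst_embl phi0 z0).
rewrite (subst_embr phi0 z0) subst_zero coef0_conj h0 rmorph0; apply/funext => e.
by rewrite /fpsC; case: eqP.
Qed.

End Maps.

Lemma S_nondegenerate_of_segre_rank (R : realType) (m d m' d' : nat)
    (M : set 'rV[R[i]]_(m + d)) (p : 'rV[R[i]]_(m + d)) (F : frame M p)
    (M' : set 'rV[R[i]]_(m' + d')) (p' : 'rV[R[i]]_(m' + d')) (F' : frame M' p')
    (h : 'I_(m' + d') -> fps 'I_(m + d) R[i]) (c : 'I_m' -> 'I_m) :
  formal_map F F' h ->
  \det (\matrix_(j, a) pder (c j)
    (fps_subst (h (free_var (frame_fields F') a)) (phi F))) != 0 ->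
  manifold_S_nondegenerate F' -> S_nondegenerate F F' h.
Proof.
move=> hF rank_y; have [h0 [mu hmu]] := hF.
have X0 (k : 'I_(m' + d')) : coef0 (fpsX k : fps 'I_(m' + d') R[i]) = 0.
  exact: coef0_fpsX.
have phi'0 := phi0 F'.
have hc0 k : coef0 (fps_conj (h k)) = 0 by rewrite coef0_conj h0 rmorph0.
move/(S_nondegenerateE F' F' X0) => ndF'; apply/(S_nondegenerateE F F' h0).
have h_maps l : fps_subst (defining (frame_fields F') l)
    (sumf (fun k => embl (h k)) (fun k => embr (fps_conj (h k))))
    = \sum_j mu l j * defining (frame_fields F) j by exact: (hmu l).
apply: (nondegenerate_transfer (phi_on_segre F) (on_segre_conj (phi_on_segre F))
  phi'0 h0 hc0 h_maps (c := c)).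
- apply: contraNneq rank_y => det0; apply/eqP/conj_eq0; rewrite -det_map_mx -[RHS]det0.
  congr (\det _); apply/matrixP => j a; rewrite [LHS]mxE [RHS]mxE mxE.
  by apply: etrans (conj_pder _ _) _; rewrite conj_subst.
(* [conj_segre_transfer] lives on the conjugate side, where the fields act, so [q] and both points
   are conjugated before it is applied. *)
- move=> q qy; apply: conj_eq0; rewrite conj_subst.
  apply: (conj_segre_transfer (on_segre_conj (image_on_segre hF))
    (on_segre_conj (phi_on_segre F')) (c := c)).
    apply: contraNneq rank_y => det0; apply/eqP/conj_eq0; rewrite -det_map_mx -[RHS]det0.
    congr (\det _); apply/matrixP => j a; rewrite [LHS]mxE [RHS]mxE mxE.
    exact: conj_pder.
  by rewrite -conj_subst qy rmorph0.
have conjX : (fun k => fps_conj (fpsX k)) = fun k => fpsX k :> fps 'I_(m' + d') R[i].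
  by apply/funext => k; exact: conj_fpsX.
have phiX : (fun k => fps_subst (fpsX k) (phi F')) = phi F'.
  by apply/funext => k; exact: (subst_fpsX phi'0).
by rewrite conjX phiX in ndF'.
Qed.

(** Passes from the chart expression [G] of the induced map to the free coordinates of the ambient
    space, in which the transfer is phrased. *)
Lemma segre_rank_of_generic_rank (R : realType) (m d m' d' : nat)
    (M : set 'rV[R[i]]_(m + d)) (p : 'rV[R[i]]_(m + d)) (F : frame M p)
    (M' : set 'rV[R[i]]_(m' + d')) (p' : 'rV[R[i]]_(m' + d')) (F' : frame M' p')
    (h : 'I_(m' + d') -> fps 'I_(m + d) R[i]) :
  segre_generic_rank_max F F' h ->
  exists c : 'I_m' -> 'I_m, \det (\matrix_(j, a) pder (c j)
    (fps_subst (h (free_var (frame_fields F') a)) (phi F))) != 0.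
Proof.
move=> [G [[G0 hG] [c detG]]]; exists c.
have -> : \matrix_(j, a) pder (c j) (fps_subst (h (free_var (frame_fields F') a)) (phi F))
    = \matrix_(j, a) pder (c j) (fps_subst (phi F' (free_var (frame_fields F') a)) G).
  by apply/matrixP => j a; rewrite [LHS]mxE [RHS]mxE hG.
exact: (segre_reparametrization_rank (phi_on_segre F') (phi_rank F') G0 detG).
Qed.

(** An invertible Jacobian of [h] preserves the rank of [phi], so h o phi is a point of the Segre
    variety of the target with rank [m] at 0, and [segre_jacobian_neq0] applies to it directly. *)
Lemma segre_rank_of_invertible (R : realType) (m d : nat)
    (M M' : set 'rV[R[i]]_(m + d)) (p p' : 'rV[R[i]]_(m + d))
    (F : frame M p) (F' : frame M' p') (h : 'I_(m + d) -> fps 'I_(m + d) R[i]) :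
  formal_map F F' h -> \rank (jac0 h) = (m + d)%N ->
  \det (\matrix_(j, a) pder (id j)
    (fps_subst (h (free_var (frame_fields F') a)) (phi F))) != 0.
Proof.
move=> hF rank_h.
have rank_y : \rank (jac0 (fun k => fps_subst (h k) (phi F))) = m.
  have full_h : row_full (jac0 h) by rewrite /row_full rank_h.
  by rewrite (jac0_comp _ (phi0 F)) (eqmxMfull _ full_h); exact: (phi_rank F).
exact: (segre_jacobian_neq0 (image_on_segre hF) rank_y).
Qed.

Theorem proposition1p5p2 (R : realType) (m d m' d' : nat)
    (hm : (0 < m)%N) (hd : (0 < d)%N) (hm' : (0 < m')%N) (hd' : (0 < d')%N)
    (M : set 'rV[R[i]]_(m + d)) (M' : set 'rV[R[i]]_(m' + d'))
    (HM : generic_submanifold M) (HM' : generic_submanifold M')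
    (p : 'rV[R[i]]_(m + d)) (p' : 'rV[R[i]]_(m' + d'))
    (Hp : M p) (Hp' : M' p')
    (F : frame M p) (F' : frame M' p')
    (h : 'I_(m' + d') -> fps 'I_(m + d) R[i])
    (Hh : formal_map F F' h) :
  (m = m' -> d = d' ->
     manifold_S_nondegenerate F' ->
     \rank (jac0 h) = (m + d)%N ->
     S_nondegenerate F F' h)
  /\
  (manifold_S_nondegenerate F' ->
     segre_generic_rank_max F F' h ->
     S_nondegenerate F F' h).
Proof.
split=> [mm dd ndF' rank_h|ndF' /segre_rank_of_generic_rank[c rank_y]].
  move: M' HM' p' Hp' F' h Hh ndF' rank_h; rewrite -mm -dd.
  move=> N' _ q' _ G' h' hG ndG' rank_h'.
  exact: (S_nondegenerate_of_segre_rank hG (segre_rank_of_invertible hG rank_h') ndG').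
exact: (S_nondegenerate_of_segre_rank Hh rank_y ndF').
Qed.
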